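(* Consider the loop dynamics on $\mathbb{Z}^2$ with a proper set of loop frequencies $f$. If $$\sum_{[\gamma]\in[\Gamma]} n_{[\gamma]}\, f_{[\gamma]}\, S_{[\gamma]}<\infty ,$$ then the loop dynamics is almost surely well defined (with respect to the joint law of couplings, initial configuration, clock rings and coins).
   Context: Let $\Gamma$ be the set of all simple loops (simple closed cycles) in the dual lattice of $\mathbb{Z}^2$. Loop frequencies are positive numbers $\{f_\gamma\}_{\gamma\in\Gamma}$. The couplings $\mathcal{J}=(J_{xy})$ on edges of $\mathbb{Z}^2$ are i.i.d. with finite first moment; the initial spins $\sigma_0\in\{-1,1\}^{\mathbb{Z}^2}$ are i.i.d. symmetric $\pm1$. Loop dynamics: each loop $\gamma$ has an independent Poisson clock of rate $f_\gamma$. When the clock of $\gamma$ rings, consider $\mathcal{H}^\gamma_{\mathcal{J}}(\sigma)=-\sum_{\langle x,y\rangle\in\gamma^*}J_{xy}\sigma_x\sigma_y$, where $\gamma^*$ is the set of primal edges whose dual edges lie on $\gamma$. If it is positive, the spins of all vertices inside $\gamma$ (in the bounded region of the plane enclosed by $\gamma$) are flipped; if it is zero these spins are flipped with probability $1/2$ according to an independent fair coin; if it is negative nothing is done. A loop $\gamma$ contains a vertex $v$ if $v$ is inside $\gamma$. $V_\gamma$ is the set of vertices that are inside $\gamma$ or are endpoints of an edge whose dual is in $\gamma$, and $S_\gamma=|V_\gamma|$. Two loops are congruent if one can be obtained from the other by a composition of translations, rotations by 90 degrees and reflections; the type $[\gamma]$ is the congruence class of $\gamma$, and $[\Gamma]$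 is the set of types. Frequencies are proper if $f_\gamma$ depends only on $[\gamma]$; then $f_{[\gamma]}=f_\gamma$, $S_{[\gamma]}=S_\gamma$, and $n_{[\gamma]}$ is the number of loops of type $[\gamma]$ which contain the origin. The dynamics being well defined means that, given the couplings, the initial configuration, all ring times and all coins, the configuration $\sigma_t$ is determined for all $t\ge0$: there is exactly one family $(\sigma_t)_{t\ge0}$ of configurations, starting from $\sigma_0$ and with right-continuous piecewise constant spins with left limits at each vertex, such that at every ring of the clock of a loop $\gamma$ the spins of all vertices inside $\gamma$ are flipped if $\mathcal{H}^\gamma_{\mathcal{J}}>0$, are flipped or not according to the associated coin if $\mathcal{H}^\gamma_{\mathcal{J}}=0$, and are left unchanged by that ring if $\mathcal{H}^\gamma_{\mathcal{J}}<0$ (with $\mathcal{H}^\gamma_{\mathcal{J}}$ evaluated at the configuration just before the ring), and such that the spin at $v$ changes only through rings of loops containing $v$. *)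

(* Defs.v *)
From HB Require Import structures.
From mathcomp Require Import all_boot all_order all_algebra finmap.
From mathcomp Require Import generic_quotient.
From mathcomp Require Import all_classical all_reals all_analysis.

Set Implicit Arguments.
Unset Strict Implicit.
Unset Printing Implicit Defensive.

Import Order.TTheory GRing.Theory Num.Theory.
Import numFieldNormedType.Exports.

Local Open Scope classical_set_scope.
Local Open Scope ring_scope.
Local Open Scope quotient_scope.

(* Both lattices are indexed by pairs of integers: as a primal vertex, (a, b)
   is the point (a, b) of the plane; as a dual vertex, it is the point
   (a + 1/2, b + 1/2). *)
Definition vertex := (int * int)%type.

Definition adjacent : rel vertex :=
  fun x y => `|x.1 - y.1| + `|x.2 - y.2| == 1.

(* The pair (x, b) encodes the undirected edge joining x to its right
   neighbour if b = false, and to its upper neighbour if b = true; every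
   edge has exactly one such code. *)
Definition edge := (vertex * bool)%type.

Definition edge_source (e : edge) : vertex := e.1.

Definition edge_target (e : edge) : vertex :=
  e.1 + (if e.2 then (0, 1) else (1, 0)).

(* The code of the edge joining two adjacent vertices x and y. *)
Definition edge_between (x y : vertex) : edge :=
  ((Num.min x.1 y.1, Num.min x.2 y.2), x.1 == y.1).

(* The primal edge crossed by a dual edge. For instance the horizontal dual
   edge from (a + 1/2, b + 1/2) to (a + 3/2, b + 1/2) crosses the vertical
   primal edge from (a + 1, b) to (a + 1, b + 1). *)
Definition crossed_edge (e : edge) : edge :=
  (e.1 + (if e.2 then (0, 1) else (1, 0)), ~~ e.2).

(* A loop is the set of dual edges of a simple closed cycle, so that the
   starting point and the orientation of the cycle are forgotten. *)
Definition simple_cycle (c : seq vertex) : bool :=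
  [&& (2 < size c)%N, uniq c & cycle adjacent c].

Definition edges_of_cycle (c : seq vertex) : {fset edge} :=
  [fset edge_between x (next c x) | x in c]%fset.

Definition is_loop (g : {fset edge}) : bool :=
  `[< exists2 c, simple_cycle c & g = edges_of_cycle c >].

Definition loop := {g : {fset edge} | is_loop g}.

Definition loop_edges (g : loop) : {fset edge} := val g.

(* The set gamma^* of primal edges. *)
Definition crossed_edges (g : loop) : {fset edge} :=
  [fset crossed_edge e | e in loop_edges g]%fset.

Section plane.
Variable R : realType.

Definition primal_point (x : vertex) : R * R := (x.1%:~R, x.2%:~R).

Definition dual_point (x : vertex) : R * R :=
  (x.1%:~R + 2^-1, x.2%:~R + 2^-1).

Definition dual_segment (e : edge) : set (R * R) :=
  [set (1 - t) *: dual_point (edge_source e) + t *: dual_point (edge_target e)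
    | t in `[0, 1]].

Definition loop_trace (g : loop) : set (R * R) :=
  \bigcup_(e in [set` loop_edges g]) dual_segment e.

Definition inside (g : loop) : set vertex :=
  [set v | ~ loop_trace g (primal_point v) /\
    bounded_set (connected_component (~` loop_trace g) (primal_point v))].

Definition loop_vertices (g : loop) : set vertex :=
  inside g `|` [set v | exists2 e, e \in crossed_edges g &
                          v = edge_source e \/ v = edge_target e].

Definition loop_size (g : loop) : \bar R := counting (loop_vertices g).

End plane.

(* Generated by the translations, the rotation by 90 degrees and the
   reflection of the dual lattice; the latter two fix the dual vertex
   (1/2, 1/2). Every composition of translations, rotations by 90 degrees
   and reflections of the plane that maps a loop to a loop restricts to such
   a map. *)
Inductive lattice_symmetry : (vertex -> vertex) -> Prop :=
| symmetry_translation a : lattice_symmetry (fun x => x + a)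
| symmetry_rotation : lattice_symmetry (fun x => (- x.2, x.1))
| symmetry_reflection : lattice_symmetry (fun x => (- x.1, x.2))
| symmetry_comp phi psi : lattice_symmetry phi -> lattice_symmetry psi ->
    lattice_symmetry (phi \o psi).

(* phi maps the edges of g onto the edges of h. *)
Definition maps_onto (phi : vertex -> vertex) (g h : loop) : Prop :=
  forall x y, adjacent x y ->
    (edge_between (phi x) (phi y) \in loop_edges h) =
    (edge_between x y \in loop_edges g).

Definition congruent (g h : loop) : bool :=
  `[< exists2 phi, lattice_symmetry phi & maps_onto phi g h >].

Lemma lattice_symmetry_adjacent phi x y : lattice_symmetry phi ->
  adjacent (phi x) (phi y) = adjacent x y.
Proof.
have subD (u v w : int) : u + w - (v + w) = u - v.
  by rewrite opprD addrACA subrr addr0.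
have normB (u v : int) : `|- u - - v| = `|u - v| by rewrite -opprD normrN.
move=> sphi; elim: sphi x y => [[a1 a2]|||phi1 phi2 _ IH1 _ IH2] [x1 x2] [y1 y2].
- by rewrite /adjacent [(_ + _).1]/= [(_ + _).2]/= !subD.
- by rewrite /adjacent [LHS]/= normB addrC.
- by rewrite /adjacent [LHS]/= normB.
- by rewrite [LHS]IH1 IH2.
Qed.

Lemma lattice_symmetry_inverse phi : lattice_symmetry phi ->
  exists2 psi, lattice_symmetry psi & cancel psi phi.
Proof.
elim=> [a|||phi1 phi2 _ [psi1 s1 k1] _ [psi2 s2 k2]].
- exists (fun x => x + - a); first exact: symmetry_translation.
  by move=> x; rewrite subrK.
- pose rot (x : vertex) : vertex := (- x.2, x.1).
  have srot : lattice_symmetry rot by exact: symmetry_rotation.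
  exists (rot \o (rot \o rot)).
    by do 2 apply: symmetry_comp => //.
  by case=> x y; rewrite /= !opprK.
- exists (fun x => (- x.1, x.2)); first exact: symmetry_reflection.
  by case=> x y; rewrite /= opprK.
- exists (psi2 \o psi1); first exact: symmetry_comp.
  by move=> x /=; rewrite k2 k1.
Qed.

Lemma congruent_refl : reflexive congruent.
Proof.
move=> g; apply/asboolP; exists (fun x => x + 0).
  exact: symmetry_translation.
by move=> x y _; rewrite !addr0.
Qed.

Lemma congruent_imply_sym g h : congruent g h -> congruent h g.
Proof.
move=> /asboolP[phi sphi gh]; apply/asboolP.
have [psi spsi psiK] := lattice_symmetry_inverse sphi.
exists psi => // x y xy.
have := gh (psi x) (psi y); rewrite !psiK => -> //.
by rewrite lattice_symmetry_adjacent.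
Qed.

Lemma congruent_sym : symmetric congruent.
Proof. by move=> g h; apply/idP/idP; exact: congruent_imply_sym. Qed.

Lemma congruent_trans : transitive congruent.
Proof.
move=> h g k /asboolP[phi sphi gh] /asboolP[psi spsi hk]; apply/asboolP.
exists (psi \o phi); first exact: symmetry_comp.
by move=> x y xy /=; rewrite hk ?gh// lattice_symmetry_adjacent.
Qed.

Canonical congruent_equiv :=
  EquivRel congruent congruent_refl congruent_sym congruent_trans.

Definition loop_type := {eq_quot congruent_equiv}.

Definition type_of (g : loop) : loop_type := \pi_loop_type g.

Section types.
Variable R : realType.

Definition proper_frequencies (f : loop -> R) : Prop :=
  forall g h, congruent g h -> f g = f h.

(* The common value of f and of loop_size on the loops of a given type are
   read off a representative; loop_size is always invariant, and f is when it
   is proper. *)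
Definition type_frequency (f : loop -> R) (t : loop_type) : R := f (repr t).

Definition type_size (t : loop_type) : \bar R := loop_size R (repr t).

Definition type_number (t : loop_type) : \bar R :=
  counting [set g | type_of g = t /\ inside R g (0, 0)].

End types.

(* true stands for the spin -1 and false for the spin +1. *)
Definition config := vertex -> bool.

Section dynamics.
Variables (R : realType) (J : edge -> R) (sigma0 : config).
(* ring g k is the time of the k-th ring (counted from 0) of the clock of g,
   and coin g k is the coin associated with this ring. *)
Variables (ring : loop -> nat -> R) (coin : loop -> nat -> bool).

Definition spin (b : bool) : R := (-1) ^+ b.

Definition energy (g : loop) (sigma : config) : R :=
  - \sum_(e <- crossed_edges g)
      J e * spin (sigma (edge_source e)) * spin (sigma (edge_target e)).

Definition flips (g : loop) (k : nat) (sigma : config) : bool :=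
  (0 < energy g sigma) || (energy g sigma == 0) && coin g k.

Definition just_before (sigma : R -> config) (t : R) : config :=
  fun v => lim (sigma u v @[u --> t^'-]).

(* The values of sigma at negative times are irrelevant. Since bool carries
   the discrete topology, right-continuity and the existence of left limits
   make the spin at v constant on some [t, t + epsilon) and on some
   (t - epsilon, t), hence piecewise constant, with finitely many jumps in
   any bounded time interval. *)
Record trajectory (sigma : R -> config) : Prop := Trajectory {
  trajectory_init : sigma 0 = sigma0;
  trajectory_right_continuous : forall v t, 0 <= t ->
    sigma u v @[u --> t^'+] --> sigma t v;
  trajectory_left_limit : forall v t, 0 < t ->
    cvg (sigma u v @[u --> t^'-]);
  trajectory_ring : forall g k v, 0 < ring g k -> inside R g v ->
    sigma (ring g k) v = just_before sigma (ring g k) v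
      (+) flips g k (just_before sigma (ring g k));
  trajectory_only_rings : forall v t, 0 < t ->
    sigma t v <> just_before sigma t v ->
    exists g k, ring g k = t /\ inside R g v
}.

Definition well_defined : Prop :=
  exists2 sigma, trajectory sigma &
    forall sigma', trajectory sigma' -> forall t, 0 <= t -> sigma' t = sigma t.

End dynamics.

Section randomness.
Context d (Omega : measurableType d) (R : realType).
Variable P : probability Omega R.

Definition mutually_independent (I : choiceType)
    (F : I -> set_system Omega) : Prop :=
  forall (A : {fset I}) (E : I -> set Omega),
    (forall i, i \in A -> F i (E i)) ->
    P (\bigcap_(i in [set` A]) E i) = (\prod_(i <- A) P (E i))%E.

Definition has_law d' (T : measurableType d') (X : {RV P >-> T})
    (mu : set T -> \bar R) : Prop :=
  forall B, measurable B -> distribution P X B = mu B.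

(* The index set of all the sources of randomness: the couplings, the initial
   spins, the waiting times of the clocks, and the coins. *)
Definition source : choiceType :=
  (edge + vertex + (loop * nat) + (loop * nat))%type.

Definition source_events (J : edge -> {RV P >-> R})
    (sigma0 : vertex -> {RV P >-> bool}) (wait : loop -> nat -> {RV P >-> R})
    (coin : loop -> nat -> {RV P >-> bool}) (s : source) : set_system Omega :=
  match s with
  | inl (inl (inl e)) => g_sigma_algebra_preimage (J e)
  | inl (inl (inr v)) => g_sigma_algebra_preimage (sigma0 v)
  | inl (inr (g, k)) => g_sigma_algebra_preimage (wait g k)
  | inr (g, k) => g_sigma_algebra_preimage (coin g k)
  end.

End randomness.

(* The Poisson clock of g: the gaps between its successive rings (the first
   one being counted from time 0) are wait g 0, wait g 1, and so on. *)
Definition ring_time (R : realType) (wait : loop -> nat -> R)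
    (g : loop) (k : nat) : R :=
  \sum_(i < k.+1) wait g i.

(* Main.v *)
(* Whether the spin at a vertex v is flipped by a ring depends only on the
   spins, just before this ring, at the endpoints of the edges crossed by
   the loop, hence on the earlier rings of the loops containing one of these
   endpoints. The dynamics is determined as soon as every vertex sees
   finitely many rings in bounded time, no two rings are simultaneous, and
   no sequence of influences runs backwards for ever: the flips are then
   defined by well-founded recursion.

   To exclude infinite sequences, give a finite chain of influencing rings
   whose latest time is T the weight e^(-lam T). Conditioning on all the
   other waiting times, a resampling of one waiting time makes e^(-lam
   max(U, Y)), with U the current time of a clock and Y the latest time of
   the chain, decrease on average by lam / f times the mean weight of the
   chain extended by the next ring. By telescoping, the extensions of a
   chain by the rings of a loop of frequency f have total mean weight at
   most f / lam times that of the chain. A loop has at most S endpoints and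
   the rates of the loops containing a vertex, weighted by S, sum to at most
   sum n f S by translation invariance; if lam is more than twice this sum,
   the chains of length n starting at a vertex have total mean weight at
   most 2^-n. So the total weight is almost surely finite, whereas the
   truncations of an infinite chain have infinite total weight. *)

From HB Require Import structures.
Require Import Defs.
From mathcomp Require Import all_boot all_order all_algebra finmap.
From mathcomp Require Import all_classical all_reals all_analysis.
From mathcomp Require Import measurable_realfun ring zify.

Import Order.TTheory GRing.Theory Num.Theory.
Import numFieldNormedType.Exports.

Local Open Scope classical_set_scope.
Local Open Scope ring_scope.

Set Implicit Arguments.
Unset Strict Implicit.
Unset Printing Implicit Defensive.

(** * Exponential waiting times *)

Section exponential_law.
Context (R : realType).
Local Notation leb := (@lebesgue_measure R).

Lemma exponential_prob_itvoy (r D : R) : 0 < r -> 0 <= D ->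
  exponential_prob r `]D, +oo[%classic = (expR (- r * D))%:E.
Proof.
move=> r0 D0; rewrite /exponential_prob.
rewrite integral_itv_obnd_cbnd; last first.
  apply/measurable_EFinP/measurable_funTS; exact: measurable_exponential_pdf.
have sub : `[D, +oo[%classic `<=` (`[0, +oo[%classic : set R).
  by apply: subset_itvr; rewrite bnd_simp.
have cexpNM : continuous (fun z : R^o => expR (- r * z)).
  move=> z; apply: continuous_comp; last exact: continuous_expR.
  exact: mulrl_continuous.
rewrite (@ge0_continuous_FTC2y _ _ (fun x => - (expR (- r * x))) _ 0)//.
- by rewrite EFinN oppeK add0e.
- by move=> x _; apply: exponential_pdf_ge0; exact: ltW.
- apply: continuous_subspaceW sub _.
  exact: within_continuous_exponential_pdf.
- rewrite -oppr0; apply: cvgN.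
  rewrite (_ : (fun x => expR (- r * x)) =
               (fun z => expR (- z)) \o (fun z => r * z)); last first.
    by apply: eq_fun => x; rewrite mulNr.
  apply: (@cvg_comp _ _ _ _ _ _ (pinfty_nbhs R)); last exact: cvgr_expR.
  exact: gt0_cvgMry.
- by apply: cvgN; apply/cvg_at_right_filter; exact: cexpNM.
- move=> z; rewrite in_itv/= andbT => Dz; apply: derive1_exponential_pdf.
  by rewrite in_itv/= andbT (le_lt_trans D0).
Qed.

(* exponential_prob is a measure on measurableTypeR R, which has the same
   measurable sets as R but another display; hence the copy nu. *)
Lemma exponential_probability (r : R) : 0 < r ->
  exists nu : probability (measurableTypeR R) R,
    forall A, measurable A -> nu A = exponential_prob r A.
Proof. by move=> r0; unshelve eexists; [exact: (exponential_prob r)|]. Qed.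

Variables (r : R) (nu : probability (measurableTypeR R) R).
Hypothesis r_gt0 : 0 < r.
Hypothesis nuE : forall A, measurable A -> nu A = exponential_prob r A.

(** The exponential density has the same integrals over measurable sets as the Radon-Nikodym
    derivative of [nu], so the two agree almost everywhere and the explicit formula can replace the
    derivative. *)
Lemma integral_exponential_prob (g : measurableTypeR R -> \bar R) A :
  measurable A -> nu.-integrable A g ->
  (\int[nu]_(x in A) g x =
   \int[leb]_(x in A) (g x * (exponential_pdf r x)%:E))%E.
Proof.
move=> mA intg.
have mpdf B : measurable_fun (B : set (measurableTypeR R))
    (fun x => (exponential_pdf r x)%:E).
  apply/measurable_EFinP/measurable_funTS; exact: measurable_exponential_pdf.
have dom : nu `<< leb.
  apply/null_content_dominatesP=> B mB muB0; rewrite nuE//.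
  by rewrite /exponential_prob; apply: null_set_integral => //; exact: mpdf.
rewrite -(@Radon_Nikodym_change_of_variables _ _ _ nu leb dom)//.
apply: ae_eq_integral => //.
- apply: emeasurable_funM => //; first exact: measurable_int intg.
  apply: measurable_funTS; apply: (measurable_int leb).
  apply: (@Radon_Nikodym_integrable _ _ _ (charge_of_finite_measure nu) leb).
  exact: dom.
- by apply: emeasurable_funM => //; exact: measurable_int intg.
- apply: ae_eqe_mul2l => /=.
  rewrite (@Radon_NikodymE _ _ _ (charge_of_finite_measure nu) leb dom)/=.
  case: cid => /= h [h1 h2 h3].
  apply: integral_ae_eq => //=; first exact: integrableS h2.
  by move=> E EA mE; rewrite -h3//= nuE.
Qed.

Variable lam : R.
Hypothesis lam_gt0 : 0 < lam.

(** The integrand times the density of rate [r] is [r / (r + lam)] times the density of rate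
    [r + lam], whose tail is explicit. *)
Lemma integral_exponential_expR D : 0 <= D ->
  (\int[nu]_(x in `]D, +oo[) (expR (- lam * x))%:E =
   (r / (r + lam) * expR (- (r + lam) * D))%:E)%E.
Proof.
move=> D0; have rl0 : 0 < r + lam by rewrite addr_gt0.
have mexp : measurable_fun setT (fun x : measurableTypeR R => expR (- lam * x)).
  by apply: measurableT_comp => //; exact: mulrl_measurable.
rewrite integral_exponential_prob//; last first.
  apply: (@le_integrable _ _ _ nu _ _ _ (cst 1%E)) => //.
  - exact/measurable_EFinP/measurable_funTS.
  - move=> x /=; rewrite in_itv/= andbT => Dx.
    rewrite normr1 ger0_norm ?expR_ge0// lee_fin -expR0 ler_expR.
    by rewrite mulNr oppr_le0 mulr_ge0 ?(ltW lam_gt0)// (le_trans D0)// ltW.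
  - exact: finite_measure_integrable_cst.
have := exponential_prob_itvoy rl0 D0; rewrite /exponential_prob EFinM => <-.
rewrite -[RHS]ge0_integralZl.
- apply: eq_integral => x; rewrite inE/= in_itv/= andbT => Dx.
  have x0 : 0 <= x by rewrite (le_trans D0)// ltW.
  rewrite !exponential_pdfE// -!EFinM; congr EFin.
  rewrite [RHS]mulrA divfK ?gt_eqF// mulrCA -expRD; congr (_ * expR _).
  by ring.
- exact: measurable_itv.
- apply/measurable_EFinP/measurable_funTS; exact: measurable_exponential_pdf.
- by move=> x _; rewrite lee_fin exponential_pdf_ge0// ltW.
- by rewrite lee_fin divr_ge0// ltW.
Qed.

(* The value at X = x of
   (lam / r) e^(-lam (u + X)) 1_(u + X > y) + e^(-lam max(u + X, y)),
   the scaled weight of a ring at time u + X, if it falls after y, plus the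
   updated discount; for X exponential of rate r, its mean is
   e^(-lam max(u, y)). *)
Definition exponential_step (u y x : R) : R :=
  if y < u + x then (lam / r + 1) * expR (- lam * (u + x))
  else expR (- lam * y).

Lemma exponential_step_ge0 u y x : 0 <= exponential_step u y x.
Proof.
rewrite /exponential_step; case: ifP => _; last exact: expR_ge0.
by rewrite mulr_ge0 ?expR_ge0// addr_ge0// divr_ge0// ltW.
Qed.

Lemma integral_exponential_step u y :
  (\int[nu]_x (exponential_step u y x)%:E =
   (expR (- lam * Num.max u y))%:E)%E.
Proof.
have mexp : measurable_fun setT (fun x : measurableTypeR R => expR (- lam * x)).
  by apply: measurableT_comp => //; exact: mulrl_measurable.
have mstep : measurable_fun setT
    (fun x : measurableTypeR R => (exponential_step u y x)%:E).
  apply/measurable_EFinP; apply: measurable_fun_ifT => //.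
    by apply: measurable_fun_ltr => //; exact: measurable_funD.
  apply: measurable_funM => //; apply: measurableT_comp => //.
  by apply: measurable_funM => //; exact: measurable_funD.
(* Above [D] the first branch of [exponential_step] applies; up to [D], either the second one does
   or, if [y <= u], the law has no mass. *)
pose D := Num.max 0 (y - u).
have D0 : 0 <= D by rewrite le_max lexx.
have nuD : nu `]D, +oo[%classic = (expR (- r * D))%:E.
  by rewrite nuE// exponential_prob_itvoy.
have nuDC : nu `]-oo, D]%classic = (1 - expR (- r * D))%:E.
  by rewrite -setCitvr probability_setC// nuD.
rewrite -(setUv `]D, +oo[%classic) ge0_integral_setU//=; last 4 first.
- exact: measurableC.
- by rewrite setUv.
- by move=> x _; rewrite lee_fin exponential_step_ge0.
- exact/disj_setPCl.
rewrite (_ : (\int[nu]_(x in `]D, +oo[) _)%E =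
    (expR (- lam * u) * expR (- (r + lam) * D))%:E); last first.
  transitivity (\int[nu]_(x in `]D, +oo[)
     (((lam / r + 1) * expR (- lam * u))%:E * (expR (- lam * x))%:E))%E.
    apply: eq_integral => x; rewrite inE/= in_itv/= andbT gt_max => /andP[_ Dx].
    by rewrite /exponential_step -ltrBlDl Dx mulrDr expRD mulrA.
  rewrite ge0_integralZl//=; last 2 first.
  - exact/measurable_EFinP/measurable_funTS.
  - by rewrite lee_fin mulr_ge0 ?expR_ge0// addr_ge0// divr_ge0// ltW.
  rewrite integral_exponential_expR// -EFinM; congr EFin.
  by field; rewrite !gt_eqF// addr_gt0.
rewrite setCitvr.
have [yu|uy] := leP y u.
  have DE : D = 0 by apply/max_idPl; rewrite subr_le0.
  rewrite null_set_integral//.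
  + by rewrite DE mulr0 expR0 mulr1 adde0.
  + exact: measurable_funTS.
  + by apply: etrans nuDC _; rewrite DE mulr0 expR0 subrr.
have DE : D = y - u by apply/max_idPr; rewrite subr_ge0 ltW.
rewrite (eq_integral (cst (expR (- lam * y))%:E)); last first.
  move=> x; rewrite inE/= in_itv/= DE => xD.
  by rewrite /exponential_step ltNge -lerBrDl xD.
rewrite integral_cst//.
rewrite [X in (_ * X)%E]nuDC -EFinM -EFinD; congr EFin.
rewrite mulrBr mulr1 -!expRD DE.
rewrite (_ : - lam * u + - (r + lam) * (y - u) = - lam * y + - r * (y - u)).
  by rewrite addrC subrK.
by ring.
Qed.

End exponential_law.

(** * Averaging over an independent variable *)

Section independent_integration.
Context d d1 d2 (T : measurableType d) (T1 : measurableType d1)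
  (T2 : measurableType d2) (R : realType).
Variables (P : probability T R) (nu : probability T1 R).
Variables (X : T -> T1) (Z : {mfun T >-> T2}).
Hypothesis mX : measurable_fun setT X.
Hypothesis XZ : forall A B, measurable A -> measurable B ->
  P (X @^-1` A `&` Z @^-1` B) = (nu A * P (Z @^-1` B))%E.

(** By uniqueness of the product measure, [XZ] makes [nu \x distribution P Z] the joint law of [X]
    and [Z]; Tonelli's theorem does the rest. *)
Lemma independent_integral (h : T1 * T2 -> \bar R) :
  measurable_fun setT h -> (forall z, 0 <= h z)%E ->
  (\int[P]_w h (X w, Z w) = \int[P]_w \int[nu]_x h (x, Z w))%E.
Proof.
move=> mh h0.
have mXZ : measurable_fun setT (fun w => (X w, Z w)).
  exact: measurable_fun_pair.
transitivity (\int[pushforward P (fun w => (X w, Z w))]_z h z)%E.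
  by rewrite ge0_integral_pushforward.
rewrite (eq_measure_integral (nu \x distribution P Z)%E); last first.
  move=> A mA _; apply: esym.
  by apply: product_measure_unique => // B C mB mC; exact: XZ.
rewrite [LHS](fubini_tonelli2 (m1 := nu) (m2 := distribution P Z) h mh h0).
rewrite ge0_integral_distribution//.
  exact: measurable_fun_fubini_tonelli_G.
by move=> y; exact: integral_ge0.
Qed.

End independent_integration.

(** * Independence of one source from all the others *)

Section other_events.
Context d (Omega : measurableType d) (R : realType) (P : probability Omega R).
Context (I : choiceType) (F : I -> set_system Omega).

(** Finite intersections are taken so that this generating class is stable under intersection, as
    the uniqueness theorem for measures requires. *)
Definition other_events (s : I) : set_system Omega :=
  [set B | exists A : {fset I}, exists2 E : I -> set Omega,
     s \notin A /\ (forall i, i \in A -> F i (E i)) &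
     B = \bigcap_(i in [set` A]) E i].

Hypothesis F_measurable : forall i A, F i A -> measurable A.
Hypothesis F_setT : forall i, F i setT.
Hypothesis F_setI : forall i, setI_closed (F i).

Lemma other_events_setI s : setI_closed (other_events s).
Proof.
move=> _ _ [A [E [sA FE] ->]] [B [G [sB FG] ->]].
exists (A `|` B)%fset; exists (fun i => (if i \in A then E i else setT) `&`
    (if i \in B then G i else setT)); first split.
- by rewrite in_fsetU negb_or sA.
- move=> i _; apply: F_setI.
  + by case: ifPn => [/FE|_].
  + by case: ifPn => [/FG|_].
- apply/seteqP; split => [w [EA GB] i /= _|w EG].
    by split; case: ifPn => // iAB; [exact: EA|exact: GB].
  by split => i /= iAB; have := EG i;
    rewrite /= in_fsetU iAB ?orbT => /(_ isT)[].
Qed.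

Lemma other_events_sub i s A : i != s -> F i A -> other_events s A.
Proof.
move=> si FA; exists [fset i]%fset; exists (fun=> A); first split.
- by rewrite in_fset1 eq_sym.
- by move=> j; rewrite in_fset1 => /eqP ->.
- apply/seteqP; split => [w Aw j //|w]; apply; by rewrite /= in_fset1.
Qed.

Lemma other_events_measurable s A : other_events s A -> measurable A.
Proof.
move=> [B [E [_ FE] ->]]; apply: fin_bigcap_measurable => // i /= iB.
exact: F_measurable (FE _ iB).
Qed.

(* Omega with the sigma-algebra generated by all the sources but s. *)
Definition others s : measurableType _ := g_sigma_algebraType (other_events s).

(** The identity as a random variable with values in the coarser space. Measurability on [others s]
    expresses dependence on the sources other than [s] alone. *)
Definition to_others s (w : Omega) : others s := w.

Lemma measurable_to_others s : measurable_fun setT (to_others s).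
Proof.
move=> _ A mA; rewrite setTI;
  suff: <<s other_events s >> `<=` @measurable _ Omega.
  exact.
apply: smallest_sub; first exact: sigma_algebra_measurable.
exact: other_events_measurable.
Qed.

HB.instance Definition _ s :=
  isMeasurableFun.Build _ _ Omega (others s) (to_others s)
    (@measurable_to_others s).

Lemma measurable_fun_others d' (T : measurableType d') i s (Y : Omega -> T) :
  i != s -> (forall B, measurable B -> F i (Y @^-1` B)) ->
  measurable_fun (setT : set (others s)) Y.
Proof.
move=> si FY _ B mB; rewrite setTI; apply: sub_sigma_algebra.
by apply: other_events_sub (FY _ mB).
Qed.

Hypothesis indep : mutually_independent P F.

(** For fixed [C], both sides are finite measures in [B]. They agree on [other_events s], by
    independence applied to a finite index set enlarged by [s], hence on the generated
    sigma-algebra. *)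
Lemma independent_others s C B : F s C -> measurable B ->
  P (C `&` to_others s @^-1` B) = (P C * P (to_others s @^-1` B))%E.
Proof.
move=> FC mB; have mC := F_measurable FC.
pose r := NngNum (fine_ge0 (measure_ge0 P C)).
have PC : P C = (r%:num)%:E by rewrite /= fineK// fin_num_measure.
pose m1 : {measure set (others s) -> \bar R} :=
  pushforward (mrestr P mC) (to_others s).
pose m2 : {measure set (others s) -> \bar R} :=
  mscale r (distribution P (to_others s)).
suff : m1 (@measurable_to_others s) B = m2 B.
  by rewrite PC /m1 /m2 /= /pushforward /mrestr /mscale/= setIC.
apply: (@measure_unique _ _ (others s) (other_events s) (fun=> setT) _ _ _ _
  (m1 (@measurable_to_others s)) m2) => //.
- exact: other_events_setI.
- move=> _; exists fset0; exists (fun=> setT) => //.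
  by apply/seteqP; split.
- by rewrite bigcup_const.
- move=> _ [A [E [sA FE] ->]].
  rewrite /m1 /m2 /= /pushforward /mrestr /mscale/= -PC.
  have PA : P (\bigcap_(i in [set` A]) E i) = (\prod_(i <- A) P (E i))%E.
    exact: indep.
  rewrite [distribution _ _ _]PA.
  have := @indep (s |` A)%fset (fun i => if i == s then C else E i).
  rewrite big_fsetU1//= eqxx => H.
  rewrite (_ : _ `&` C = \bigcap_(i in [set` (s |` A)%fset])
     (if i == s then C else E i)); last first.
    apply/seteqP; split => [w [EA Cw] i /=|w ECw].
      by rewrite in_fset1U; case: eqP => // _; exact: EA.
    split => [i /= iA|]; last by have := ECw s; rewrite /= in_fset1U eqxx;
      exact.
    have := ECw i; rewrite /= in_fset1U iA orbT => /(_ isT).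
    by case: eqP => // is_; rewrite -is_ iA in sA.
  rewrite H; last first.
    by move=> i; rewrite in_fset1U; case: eqP => [->|_ /=] //; exact: FE.
  congr (_ * _)%E; rewrite !big_seq; apply: eq_bigr => i iA.
  by case: eqP => // is_; rewrite -is_ iA in sA.
- move=> _; rewrite /m1 /= /pushforward /mrestr/=.
  rewrite preimage_setT setTI.
  exact: le_lt_trans (probability_le1 _ mC) (ltry _).
Qed.

End other_events.

(** * Sums of nonnegative families and almost sure finiteness *)

Section esum_extra.
Context (R : realType).
Local Open Scope ereal_scope.

Lemma le_esum_scale (T : choiceType) (A : set T) (a b : T -> \bar R) (c : R) :
  (0 <= c)%R -> (forall x, A x -> 0 <= b x) ->
  (forall x, A x -> a x <= c%:E * b x) ->
  \esum_(x in A) a x <= c%:E * \esum_(x in A) b x.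
Proof.
move=> c0 b0 ab; apply: ge_ereal_sup => _ [X [finX XA] <-].
rewrite fsbig_finite//= big_seq.
apply: (@le_trans _ _ (\sum_(x <- fset_set X | x \in fset_set X) (c%:E * b x))).
  apply: lee_sum => x; rewrite in_fset_set// inE => Xx.
  exact/ab/XA.
rewrite -ge0_sume_distrr; last first.
  by move=> x; rewrite in_fset_set// inE => /XA/b0.
rewrite -big_seq; apply: lee_wpmul2l; first by rewrite lee_fin.
by apply: ereal_sup_ubound; exists X => //; rewrite fsbig_finite.
Qed.

Lemma esum_subset (T : choiceType) (A B : set T) (a : T -> \bar R) :
  A `<=` B -> (forall x, 0 <= a x) ->
  \esum_(x in A) a x <= \esum_(x in B) a x.
Proof.
move=> AB a0; apply: ge_ereal_sup => _ [X [finX XA] <-].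
by apply: ereal_sup_ubound; exists X => //; split=> //; exact: subset_trans AB.
Qed.

Lemma esum_fset_bigcup (T U : choiceType) (N : {fset U}) (S : U -> set T)
    (a : T -> \bar R) : (forall x, 0 <= a x) ->
  \esum_(x in \bigcup_(u in [set` N]) S u) a x <=
  \sum_(u <- N) \esum_(x in S u) a x.
Proof.
move=> a0; under eq_bigr do rewrite esum_mkcond.
rewrite -esum_sum; last by move=> x u _ _; case: ifP.
rewrite esum_mkcond; apply: le_esum => x _.
case: ifPn => [|_]; last by apply: sume_ge0 => u _; case: ifP.
rewrite inE => -[u /= uN Sux].
rewrite (big_fsetD1 u)//= mem_set//; apply: leeDl.
by apply: sume_ge0 => z _; case: ifP.
Qed.

(** This turns an unordered sum into a series, which can be interchanged with an integral; codes of
    no element of [A] contribute 0. *)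
Lemma esum_countType (T : countType) (A : set T) (a : T -> \bar R) :
  (forall x, 0 <= a x) ->
  \esum_(x in A) a x =
  \sum_(n <oo) (if pickle_inv n is Some x then
                  if x \in A then a x else 0 else 0).
Proof.
move=> a0; rewrite nneseries_esumT; last first.
  by move=> n; case: pickle_inv => // x; case: ifP.
rewrite esum_mkcond.
transitivity (\esum_(n in [set choice.pickle x | x in [set: T]])
    (if pickle_inv n is Some x then if x \in A then a x else 0 else 0)).
  rewrite esum_image; last by move=> x y _ _; exact: (pcan_inj choice.pickleK).
  by apply: eq_esum => x _; rewrite pickleK_inv.
rewrite esum_mkcond; apply: eq_esum => n _; case: ifPn => // /negP H.
case E : pickle_inv => [x|//]; exfalso; apply: H; rewrite inE; exists x => //.
by have := @pickle_invK T n; rewrite E.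
Qed.

Lemma esum_cst_counting (T : choiceType) (A : set T) (c : \bar R) : 0 <= c ->
  \esum_(x in A) c <= counting A * c.
Proof.
move=> c0; rewrite /counting; case: asboolP => [finA|infA].
  rewrite -(set_mem_set A) esum_fset//; last by rewrite set_mem_set.
  rewrite set_mem_set fsbig_finite//= big_const_seq count_predT.
  elim: (size _) => [|n IH] /=; first by rewrite mul0e.
  rewrite -natr1 EFinD ge0_muleDl ?lee_fin// mul1e addeC.
  exact: leeD.
(* For infinite [A] the bound is infinite unless [c = 0], where both sides vanish because infinity
   times 0 is 0. *)
have [->|cn0] := eqVneq c 0; first by rewrite esum1// mule0.
by rewrite gt0_mulye ?leey// lt_neqAle eq_sym cn0.
Qed.

End esum_extra.

(** If there were infinitely many terms at least [c], some finite set of them would have more than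
    (total sum) / [c] elements and exceed the sum. *)
Lemma esum_lty_finite (R : realType) (T : choiceType) (A : set T)
    (a : T -> \bar R) (c : R) : 0 < c -> (forall x, 0 <= a x)%E ->
  (\esum_(x in A) a x < +oo)%E -> finite_set [set x | A x /\ (c%:E <= a x)%E].
Proof.
move=> c0 a0 fin; apply: contrapT => /infinite_set_fset inf.
have sum_ge0 : (0 <= \esum_(x in A) a x)%E by apply: esum_ge0.
have sum_fin : (\esum_(x in A) a x)%E \is a fin_num by rewrite ge0_fin_numE.
have [n] : exists n : nat, fine (\esum_(x in A) a x) / c < n%:R.
  exists (Num.bound (fine (\esum_(x in A) a x) / c)); apply: archi_boundP.
  by rewrite divr_ge0 ?fine_ge0// ltW.
have [B BA Bn] := inf n.
rewrite ltr_pdivrMr// ltNge => /negP; apply.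
rewrite -lee_fin fineK//; apply: (@le_trans _ _ (\sum_(x <- B) c%:E)%E).
  rewrite sumEFin big_const_seq count_predT iter_addr_0 lee_fin
    -[leRHS]mulr_natl.
  by rewrite ler_wpM2r ?ler_nat// ltW.
apply: (@le_trans _ _ (\sum_(x <- B) a x)%E).
  rewrite big_seq [leRHS]big_seq; apply: lee_sum => x xB.
  by have [] := BA _ xB.
apply: ereal_sup_ubound; exists [set` B].
  by split; [exact: finite_fset|move=> x /BA[]].
by rewrite fsbig_finite//= set_fsetK.
Qed.

Section countable_ae.
Context d (T : measurableType d) (R : realType).
Variable mu : {measure set T -> \bar R}.

Lemma ae_forall_countType (I : countType) (Q : I -> T -> Prop) :
  (forall i, \forall x \ae mu, Q i x) -> \forall x \ae mu, forall i, Q i x.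
Proof.
move=> aeQ.
have : \forall x \ae mu, forall n,
    if pickle_inv n is Some i then Q i x else True.
  apply: ae_foralln => n; case: pickle_inv => [i//|]; exact: aeW.
by apply: filterS => x + i => /(_ (choice.pickle i)); rewrite pickleK_inv.
Qed.

(** The sum of the integrals is the integral of the sum, and a function of finite integral is finite
    almost everywhere. *)
Lemma ae_esum_lty (I : countType) (A : set I) (a : I -> T -> \bar R) :
  (forall i, measurable_fun setT (a i)) -> (forall i x, 0 <= a i x)%E ->
  (\esum_(i in A) \int[mu]_x a i x < +oo)%E ->
  \forall x \ae mu, (\esum_(i in A) a i x < +oo)%E.
Proof.
move=> ma a0; rewrite esum_countType; last by move=> i; exact: integral_ge0.
pose b n x := (if @pickle_inv I n is Some i then
                 if i \in A then a i x else 0 else 0)%E.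
have b0 n x : (0 <= b n x)%E.
  by rewrite /b; case: pickle_inv => // i; case: ifP.
have mb n : measurable_fun setT (b n).
  rewrite /b; case: pickle_inv => [i|]; last exact: measurable_cst.
  by case: (i \in A) => //; exact: measurable_cst.
rewrite [X in (X < _)%E](_ : _ = (\int[mu]_x \sum_(n <oo) b n x)%E); last first.
  rewrite integral_nneseries//; apply: eq_eseriesr => n _; rewrite /b.
  case: pickle_inv => [i|]; last exact/esym/integral0.
  by case: (i \in A) => //; exact/esym/integral0.
move=> fin.
have /integrable_ae : mu.-integrable setT (fun x => \sum_(n <oo) b n x)%E.
  apply/integrableP; split; first exact: ge0_emeasurable_sum.
  under eq_integral do rewrite gee0_abs ?nneseries_ge0//.
  exact: fin.
move=> /(_ measurableT); apply: filterS => x /(_ Logic.I).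
by rewrite esum_countType// => /fin_numPlt/andP[].
Qed.

End countable_ae.

(** From [n] on, [a k] is [r] times the decrease of [b] at [k]; the relation is written additively
    to avoid subtracting extended reals. *)
Lemma telescoping_le (R : realType) (r : R) (a b : nat -> \bar R) (n N : nat) :
  0 < r -> (forall k, 0 <= a k)%E -> (forall k, 0 <= b k)%E ->
  (forall k, (n <= k)%N -> (r^-1%:E * a k + b k.+1 = b k)%E) ->
  (forall k, (k < n)%N -> a k = 0%E) ->
  (\sum_(0 <= k < N) a k <= r%:E * b n)%E.
Proof.
move=> r0 a0 b0 ab an.
have rb0 k : (0 <= r%:E * b k)%E by rewrite mule_ge0// lee_fin ltW.
have tele m : (\sum_(n <= k < n + m) a k + r%:E * b (n + m)%N = r%:E * b n)%E.
  elim: m => [|m IH]; first by rewrite addn0 big_geq// add0e.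
  rewrite -IH addnS big_nat_recr ?leq_addr//= -addeA; congr (_ + _)%E.
  rewrite -[in RHS](ab (n + m)%N) ?leq_addr// ge0_muleDr ?mule_ge0//.
    by rewrite muleA -EFinM divff ?gt_eqF// mul1e.
  by rewrite lee_fin invr_ge0 ltW.
rewrite -(tele N); apply: (@le_trans _ _ (\sum_(n <= k < n + N) a k)%E).
  apply: (@le_trans _ _ (\sum_(0 <= k < n + N) a k)%E).
    by apply: lee_sum_nneg_natr => //; rewrite leq_addl.
  rewrite (@big_cat_nat _ _ _ n)//= ?leq_addr//.
  by rewrite big_nat big1 ?add0e// => k /andP[_ kn]; exact: an.
exact: leeDl.
Qed.

(** * Chains of rings *)

(* An event (g, k) is the k-th ring of g; a chain lists events backwards in
   time, the latest one first. *)
Section chains.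
Context (R : realType) (L : countType).
Implicit Types (wt : L -> nat -> R) (es : seq (L * nat)).

Definition clock wt (g : L) (k : nat) : R := \sum_(i < k) wt g i.

Definition event_time wt (e : L * nat) : R := clock wt e.1 e.2.+1.

(** The empty chain gets the starting time 0, hence weight 1. *)
Definition last_time wt es : R := if es is e :: _ then event_time wt e else 0.

(** The event [(g, k)] involves the waiting times of [g] of indices 0 to [k], so the times of the
    events of [es] involve those of [g] only below this index. *)
Definition next_index (g : L) es : nat := \max_(e <- es | e.1 == g) e.2.+1.

(* The condition on next_index follows from the one on times, almost surely. It
   ensures that the event times of es' do not depend on the waiting time that
   precedes e, pathwise rather than almost surely. *)
Fixpoint descending wt es : bool :=
  if es is e :: es' then
    [&& (next_index e.1 es' <= e.2)%N, last_time wt es' < event_time wt e &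
        descending wt es']
  else true.

Definition weight (lam : R) wt es : R :=
  if descending wt es then expR (- lam * last_time wt es) else 0.

Lemma weight_ge0 lam wt es : 0 <= weight lam wt es.
Proof. by rewrite /weight; case: ifP => // _; exact: expR_ge0. Qed.

Lemma next_index_le g e es : e \in es -> e.1 = g -> (e.2 < next_index g es)%N.
Proof.
by move=> ees eg; rewrite /next_index (big_rem e)//= eg eqxx leq_maxl.
Qed.

Section measurability.
Context d (T : measurableType d) (wt : T -> L -> nat -> R).

Lemma measurable_clock g k :
  (forall i, (i < k)%N -> measurable_fun setT (fun w => wt w g i)) ->
  measurable_fun setT (fun w => clock (wt w) g k).
Proof.
rewrite /clock; elim: k => [|k IH] mwt.
  by under eq_fun do rewrite big_ord0; exact: measurable_cst.
under eq_fun do rewrite big_ord_recr/=.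
by apply: measurable_funD; [apply: IH => i /ltnW ik|]; exact: mwt.
Qed.

(** Only the waiting times that enter the event times of [es] are assumed measurable, so that the
    lemma also applies on [others s], where one waiting time is forgotten. *)
Lemma measurable_descending es :
  (forall e i, e \in es -> (i <= e.2)%N -> measurable_fun setT (fun w => wt w
    e.1 i)) ->
  measurable_fun setT (fun w => last_time (wt w) es) /\
  measurable_fun setT (fun w => descending (wt w) es).
Proof.
elim: es => [|e es IH] mwt; first by split => /=; exact: measurable_cst.
have [|ml md] := IH.
  by move=> e' i e'es; apply: mwt; rewrite inE e'es orbT.
have me : measurable_fun setT (fun w => event_time (wt w) e).
  by apply: measurable_clock => i ie; apply: mwt; rewrite ?inE ?eqxx.
split => //=.
apply: measurable_and; first exact: measurable_cst.
apply: measurable_and => //.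
exact: measurable_fun_ltr.
Qed.

Lemma measurable_weight lam es :
  (forall g i, measurable_fun setT (fun w => wt w g i)) ->
  measurable_fun setT (fun w => (weight lam (wt w) es)%:E).
Proof.
move=> mwt; have [//|ml md] := @measurable_descending es.
apply/measurable_EFinP; apply: measurable_fun_ifT => //.
apply: measurableT_comp => //.
exact: measurable_funM.
Qed.

End measurability.
End chains.
Section reaches.
Context (L : Type) (V : choiceType) (ins : L -> set V) (N : L -> {fset V}).

(** [N g] is meant as the set of vertices whose spins decide a ring of [g]. A witness [u] is asked
    for even after the last event, so a chain can only end at a loop with nonempty [N]. *)
Fixpoint reaches (v : V) (es : seq (L * nat)) : Prop :=
  if es is e :: es' then
    ins e.1 v /\ exists2 u, u \in N e.1 & reaches u es'
  else True.

Definition chains (n : nat) (v : V) : set (seq (L * nat)) :=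
  [set es | size es = n /\ reaches v es].

End reaches.

(** * Resampling of waiting times and mean weight of chains *)

Section clocks.
Context d (Omega : measurableType d) (R : realType) (P : probability Omega R).
Context (I : choiceType) (F : I -> set_system Omega).
Hypothesis F_measurable : forall i A, F i A -> measurable A.
Hypothesis F_setT : forall i, F i setT.
Hypothesis F_setI : forall i, setI_closed (F i).
Hypothesis indep : mutually_independent P F.
Context (L : countType) (f : L -> R) (wait : L -> nat -> {RV P >-> R}).
Hypothesis f_gt0 : forall g, 0 < f g.
Hypothesis wait_law : forall g k, has_law (wait g k) (exponential_prob (f g)).
Variable src : L -> nat -> I.
Hypothesis src_inj : forall g h k l, src g k = src h l -> (g, k) = (h, l).
Hypothesis wait_src : forall g k B, measurable B -> F (src g k) (wait g k
  @^-1` B).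

Let wt (w : Omega) g k : R := wait g k w.

(** By the measurability of [h] on [others], [w] enters [h x w] only through the other sources, of
    which the waiting time is independent. *)
Lemma resample_wait g k (h : R -> Omega -> \bar R)
    (nu : probability (measurableTypeR R) R) :
  (forall A, measurable A -> nu A = exponential_prob (f g) A) ->
  measurable_fun setT
    (fun z : measurableTypeR R * others F (src g k) => h z.1 z.2) ->
  (forall x w, 0 <= h x w)%E ->
  (\int[P]_w h (wait g k w) w = \int[P]_w \int[nu]_x h x w)%E.
Proof.
move=> nuE mh h0.
have mX : measurable_fun setT (wait g k : Omega -> measurableTypeR R).
  by move=> mT A mA; exact: (measurable_funPT (wait g k) mT A mA).
apply: (@independent_integral _ _ _ _ _ _ _ P nu (wait g k)
  (to_others F (src g k)) mX _ (fun z => h z.1 z.2) mh) => // A B mA mB.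
rewrite (independent_others F_measurable F_setT F_setI indep)//.
  by rewrite nuE//; congr (_ * _)%E; exact: wait_law.
exact: wait_src.
Qed.

Lemma measurable_wt_others g k h l : (h, l) != (g, k) ->
  measurable_fun (setT : set (others F (src g k))) (fun w => wt w h l).
Proof.
move=> hl; apply: (@measurable_fun_others _ _ I F _ _ (src h l)).
  by apply: contra_neq hl => /src_inj.
exact: wait_src.
Qed.

Variable lam : R.
Hypothesis lam_gt0 : 0 < lam.

(** The discount e^(-lam max(U, Y)) once the clock of [g] has rung [k] times: U is the time of its
    latest ring (0 if [k = 0]) and Y the latest time of [es]. *)
Let delayed es g k (w : Omega) : R :=
  if descending (wt w) es
  then expR (- lam * Num.max (clock (wt w) g k) (last_time (wt w) es)) else 0.

Let measurable_wt g k : measurable_fun setT (fun w => wt w g k).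
Proof. exact: measurable_funPT. Qed.

Let delayed_ge0 es g k w : 0 <= delayed es g k w.
Proof. by rewrite /delayed; case: ifP => // _; exact: expR_ge0. Qed.

Let measurable_delayed es g k :
  measurable_fun setT (fun w => (delayed es g k w)%:E).
Proof.
have [//|ml md] := @measurable_descending _ _ _ _ wt es.
apply/measurable_EFinP; apply: measurable_fun_ifT => //.
apply: measurableT_comp => //; apply: measurable_funM => //.
by apply: measurable_maxr => //; exact: measurable_clock.
Qed.

(* As a function of the waiting time that precedes the k-th ring of g, the sum
   of the scaled integrands on the left is an exponential_step. *)
Lemma weight_delayed es g k : (next_index g es <= k)%N ->
  ((lam / f g)%:E * \int[P]_w (weight lam (wt w) ((g, k) :: es))%:E +
   \int[P]_w (delayed es g k.+1 w)%:E = \int[P]_w (delayed es g k w)%:E)%E.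
Proof.
move=> gk; have lf0 : 0 <= lam / f g by rewrite divr_ge0// ltW.
pose h x w := (if descending (wt w) es then
  exponential_step (f g) lam (clock (wt w) g k) (last_time (wt w) es) x
  else 0)%:E.
have [nu nuE] := exponential_probability (f_gt0 g).
transitivity (\int[P]_w h (wait g k w) w)%E.
  rewrite -ge0_integralZl_EFin//; last 2 first.
  - by move=> w _; rewrite lee_fin weight_ge0.
  - exact: measurable_weight.
  rewrite -ge0_integralD//.
  - apply: eq_integral => w _; rewrite -EFinD /h; congr EFin.
    rewrite /weight /delayed /= gk /=; case: (descending _ _); last first.
      by rewrite andbF mulr0 addr0.
    rewrite andbT /exponential_step /event_time /= /clock big_ord_recr/=.
    rewrite -/(clock _ _ _) -/(wt w g k).
    have [lt|ge] := ltP (last_time (wt w) es) (clock (wt w) g k + wt w g k).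
      by rewrite mulrDl mul1r.
    by rewrite mulr0 add0r.
  - by move=> w _; rewrite -EFinM lee_fin mulr_ge0// weight_ge0.
  - apply/measurable_EFinP; apply: measurable_funM => //.
    by apply/measurable_EFinP; exact: measurable_weight.
  - by move=> w _; rewrite lee_fin.
rewrite (resample_wait nuE).
- apply: eq_integral => w _; rewrite /h /delayed.
  case: (descending _ _); first exact: integral_exponential_step.
  by rewrite integral0.
(* The events of [es] on the clock of [g] have indices below [k], so their times do not involve
   [wt w g k]; neither does [clock (wt w) g k], a sum over indices below [k]. *)
- have mo e i : e \in es -> (i <= e.2)%N -> measurable_fun
      (setT : set (others F (src g k))) (fun w => wt w e.1 i).
    move=> ees ie; apply: measurable_wt_others; apply/eqP => -[eg ik].
    by have := leq_trans (next_index_le ees eg) gk; rewrite -ik ltnNge ie.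
  have [ml md] := measurable_descending mo.
  have mc : measurable_fun (setT : set (others F (src g k)))
      (fun w => clock (wt w) g k).
    apply: measurable_clock => i ik; apply: measurable_wt_others.
    by apply/eqP => -[]; apply/eqP; rewrite ltn_eqF.
  apply/measurable_EFinP; apply: measurable_fun_ifT => //.
    exact: (measurableT_comp md).
  have msnd := @measurable_snd _ _ (measurableTypeR R) (others F (src g k)).
  have mc2 := measurableT_comp mc msnd.
  have ml2 := measurableT_comp ml msnd.
  have mcx : measurable_fun setT (fun z : measurableTypeR R * others F (src g k)
      => clock (wt z.2) g k + z.1).
    exact: (measurable_funD mc2 measurable_fst).
  apply: measurable_fun_ifT.
  + exact: (measurable_fun_ltr ml2 mcx).
  + apply: (measurable_funM (measurable_cst _)).
    apply: (measurableT_comp (@measurable_expR R)).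
    exact: (measurable_funM (measurable_cst _) mcx).
  + apply: (measurableT_comp (@measurable_expR R)).
    exact: (measurable_funM (measurable_cst _) ml2).
- move=> x w; rewrite /h lee_fin; case: (descending _ _) => //.
  exact: exponential_step_ge0.
Qed.

(** The mean weights telescope from [next_index g es] on and vanish before it. The initial discount
    is at most the weight of [es], because the maximum is at least [last_time]. *)
Lemma sum_weight_cons es g N :
  (\sum_(0 <= k < N) \int[P]_w (weight lam (wt w) ((g, k) :: es))%:E <=
   (f g / lam)%:E * \int[P]_w (weight lam (wt w) es)%:E)%E.
Proof.
have mw es' : measurable_fun setT (fun w => (weight lam (wt w) es')%:E).
  exact: measurable_weight.
have w0 es' w : (0 <= (weight lam (wt w) es')%:E)%E by rewrite lee_fin
  weight_ge0.
set b := next_index g es.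
have fl0 : 0 < f g / lam by rewrite divr_gt0.
apply: (@le_trans _ _ ((f g / lam)%:E * \int[P]_w (delayed es g b w)%:E)%E).
  apply: (@telescoping_le _ _
    (fun k => \int[P]_w (weight lam (wt w) ((g, k) :: es))%:E)%E
    (fun k => \int[P]_w (delayed es g k w)%:E)%E b) => //.
  - by move=> k; exact: integral_ge0.
  - by move=> k; apply: integral_ge0 => w _; rewrite lee_fin.
  - by move=> k bk; rewrite invf_div; exact: weight_delayed.
  - by move=> k kb; apply: integral0_eq => w _; rewrite /weight/= leqNgt kb.
apply: lee_wpmul2l; first by rewrite lee_fin ltW.
apply: ge0_le_integral => //.
- by move=> w _; rewrite lee_fin.
- move=> w _; rewrite lee_fin /delayed /weight.
  case: ifP => // _; rewrite ler_expR !mulNr lerN2.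
  by rewrite ler_wpM2l ?(ltW lam_gt0)// le_max lexx orbT.
Qed.

Context (V : countType) (ins : L -> set V) (N : L -> {fset V}).
Hypothesis rate_le : forall v,
  (\esum_(g in [set g | ins g v]) (f g / lam * #|` N g|%:R)%:E <= (2^-1)%:E)%E.

Let mean_weight es : \bar R := (\int[P]_w (weight lam (wt w) es)%:E)%E.

Let mean_weight_ge0 es : (0 <= mean_weight es)%E.
Proof. by apply: integral_ge0 => w _; rewrite lee_fin weight_ge0. Qed.

Lemma esum_weight_cons es g :
  (\esum_(k in [set: nat]) mean_weight ((g, k) :: es) <=
   (f g / lam)%:E * mean_weight es)%E.
Proof.
rewrite -nneseries_esumT//; apply: lime_le; first exact: is_cvg_nneseries.
by apply: nearW => n; exact: sum_weight_cons.
Qed.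

(** A chain of length [n + 1] is a loop [g] around [v], an index [k] and a chain of length [n] from
    some [u] in [N g]. Summing over [k] costs [f g / lam], the choice of [u] at most the cardinal of
    [N g], and [rate_le] bounds the sum over [g] by 1/2. *)
Lemma esum_chains n v :
  (\esum_(es in chains ins N n v) mean_weight es <= ((2^-1) ^+ n)%:E)%E.
Proof.
elim: n v => [|n IH] v.
  rewrite (_ : chains _ _ _ _ = [set [::]]); last first.
    by apply/seteqP; split => [es [/size0nil->]|_ ->].
  rewrite esum_set1// /mean_weight.
  under eq_integral do rewrite /weight/= mulr0 expR0.
  by rewrite integral_cst// mul1e [leLHS]probability_setT.
pose B g : set (seq (L * nat)) := \bigcup_(u in [set` N g]) chains ins N n u.
pose D := [set g | ins g v] `*`` (fun g => B g `*`` (fun=> [set: nat])).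
rewrite (reindex_esum D _ (fun z => (z.1, z.2.2) :: z.2.1)); last first.
  split.
  - move=> [g [es k]] [/= gv [[u uN [<- ues]] _]]; split => //.
    by split => //; exists u.
  - by move=> [g [es k]] [h [es' l]] _ _ /= [-> -> ->].
  - move=> [|[g k] es] [//= [sz] [gv [u uN ues]]]; exists (g, (es, k)) => //.
    by split => //; split => //; exists u.
rewrite -(@esum_esum _ _ _ [set g | ins g v] _
  (fun g z => mean_weight ((g, z.2) :: z.1)))//.
apply: (@le_trans _ _ (((2^-1) ^+ n)%:E *
    \esum_(g in [set g | ins g v]) (f g / lam * #|` N g|%:R)%:E)%E).
  apply: le_esum_scale; first by rewrite exprn_ge0.
    by move=> g _; rewrite lee_fin mulr_ge0// divr_ge0// ltW.
  move=> g gv.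
  rewrite -(@esum_esum _ _ _ (B g) _ (fun es k => mean_weight ((g, k) ::
    es)))//.
  apply: (@le_trans _ _ ((f g / lam)%:E * \esum_(es in B g) mean_weight es)%E).
    apply: le_esum_scale => //; first by rewrite divr_ge0// ltW.
    by move=> es _; exact: esum_weight_cons.
  rewrite [(_ * _%:R)%:E]EFinM muleCA; apply: lee_wpmul2l;
    first by rewrite lee_fin divr_ge0// ltW.
  apply: le_trans (esum_fset_bigcup _ _ mean_weight_ge0) _.
  apply: (@le_trans _ _ (\sum_(u <- N g) ((2^-1) ^+ n)%:E)%E).
    by apply: lee_sum => u _; exact: IH.
  by rewrite sumEFin big_const_seq count_predT iter_addr_0 -EFinM mulr_natr.
by rewrite exprSr EFinM; apply: lee_wpmul2l (rate_le v);
  rewrite lee_fin exprn_ge0.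
Qed.

Lemma esum_reaches_lty v :
  (\esum_(es in [set es | reaches ins N v es]) mean_weight es < +oo)%E.
Proof.
have sum_ge0 S : (0 <= \esum_(es in S) mean_weight es)%E.
  by refine (esum_ge0 _).
rewrite (_ : [set es | _] = \bigcup_n chains ins N n v); last first.
  apply/seteqP; split => [es ves|es [n _ [_ ves]]//].
  by exists (size es).
rewrite esum_bigcupT//; last first.
  by move=> i j _ _ [es [[<- _] [<- _]]].
rewrite -nneseries_esumT; last by move=> n; exact: sum_ge0.
(* The terms of this series are [2 / 2 ^ (n + 1)], that is 2^-n. *)
have /cvg_lim h := @cvg_geometric_eseries_half R 2 0.
apply: (@le_lt_trans _ _ (2 / 2 ^+ 0)%:E); last exact: ltry.
rewrite -[leRHS]h//; apply: lee_nneseries => [n _ _|n _]; first exact: sum_ge0.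
apply: le_trans (esum_chains n v) _; rewrite lee_fin addn1.
by rewrite expnS natrM invfM mulrA divff// mul1r natrX exprVn.
Qed.

Lemma ae_chains_lty : \forall w \ae P, forall v,
  (\esum_(es in [set es | reaches ins N v es]) (weight lam (wt w) es)%:E <
    +oo)%E.
Proof.
apply: ae_forall_countType => v; apply: ae_esum_lty (esum_reaches_lty v).
- by move=> es; exact: measurable_weight.
- by move=> es w; rewrite lee_fin weight_ge0.
Qed.

Lemma ae_wait_gt0 : \forall w \ae P, forall g k, 0 < wt w g k.
Proof.
apply: ae_forall_countType => g; apply: ae_forall_countType => k.
exists (wait g k @^-1` `]-oo, 0]); split.
- exact: measurable_funPTI.
- apply: etrans (@wait_law g k `]-oo, 0]%classic (measurable_itv _)) _.
  have [nu nuE] := exponential_probability (f_gt0 g).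
  rewrite -nuE// -setCitvr probability_setC// nuE//.
  by rewrite exponential_prob_itvoy// mulr0 expR0 subee.
- by move=> w /= /negP; rewrite -leNgt in_itv.
Qed.

(** Given all the other sources, equality of the times of [(g, k)] and [(h, l)] with [g != h] fixes
    the value of [wait g k], and the exponential law has no atoms. *)
Lemma ae_event_time_neq : \forall w \ae P, forall e e', e.1 != e'.1 ->
  event_time (wt w) e != event_time (wt w) e'.
Proof.
apply: ae_forall_countType => -[g k]; apply: ae_forall_countType => -[h l].
have [->|gh] := eqVneq g h; first exact: aeW.
have met e : measurable_fun setT (fun w => event_time (wt w) e).
  exact: measurable_clock.
pose E := [set w | event_time (wt w) (g, k) = event_time (wt w) (h, l)].
have mE : measurable E.
  rewrite -[E]setTI (_ : E = (fun w => event_time (wt w) (g, k) ==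
     event_time (wt w) (h, l)) @^-1` [set true]).
    exact: (measurable_fun_eqr (met _) (met _)).
  by apply/seteqP; split => w /=; [move=> /eqP|move=> /eqP].
exists E; split => //; last first.
  by move=> w /= /not_implyP[_ /negP/negPn/eqP].
have [nu nuE] := exponential_probability (f_gt0 g).
rewrite -[E]setIT -integral_indic//.
pose u x w := (clock (wt w) g k + x == event_time (wt w) (h, l))%:R%:E : \bar R.
transitivity (\int[P]_w u (wait g k w) w)%E.
  apply: eq_integral => w _; rewrite /u indicE; congr ((nat_of_bool _)%:R%:E).
  rewrite (_ : _ + _ = event_time (wt w) (g, k)); last first.
    by rewrite /event_time/= /clock [RHS]big_ord_recr.
  by apply/idP/eqP; rewrite inE.
rewrite (resample_wait nuE).
- have nu1 c : nu [set c] = 0%E.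
    apply: etrans (nuE _ (measurable_set1 _)) _.
    by rewrite /exponential_prob integral_set1.
  rewrite integral0_eq// => w _.
  rewrite (eq_integral (fun x : measurableTypeR R =>
    (\1_[set event_time (wt w) (h, l) - clock (wt w) g k] x)%:E)).
    by rewrite integral_indic// setIT; exact: nu1.
  move=> x _; rewrite /u indicE; congr ((nat_of_bool _)%:R%:E).
  apply/eqP/idP; rewrite inE/=; first by move=> <-; rewrite addrC addKr.
  by move=> ->; rewrite addrC subrK.
- have mo i : measurable_fun (setT : set (others F (src g k))) (fun w => wt w
  h i).
    apply: measurable_wt_others; by apply/eqP => -[hg]; rewrite hg eqxx in gh.
  have mc : measurable_fun (setT : set (others F (src g k)))
      (fun w => clock (wt w) g k).
    apply: measurable_clock => i ik; apply: measurable_wt_others.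
    by apply/eqP => -[]; apply/eqP; rewrite ltn_eqF.
  have mt : measurable_fun (setT : set (others F (src g k)))
      (fun w => event_time (wt w) (h, l)).
    by apply: measurable_clock => i _; exact: mo.
  have msnd := @measurable_snd _ _ (measurableTypeR R) (others F (src g k)).
  have mcx : measurable_fun setT (fun z : measurableTypeR R * others F (src g k)
      => clock (wt z.2) g k + z.1).
    exact: (measurable_funD (measurableT_comp mc msnd) measurable_fst).
  have mt2 := measurableT_comp mt msnd.
  apply/measurable_EFinP.
  rewrite (_ : (fun _ => _) = (fun z => if clock (wt z.2) g k + z.1 ==
     event_time (wt z.2) (h, l) then 1 else 0)); last first.
    by apply/funext => z; case: eqP.
  apply: measurable_fun_ifT; try exact: measurable_cst.
  exact: (measurable_fun_eqr mcx mt2).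
- by move=> x w; rewrite lee_fin.
Qed.

End clocks.

(** * The deterministic dynamics *)

Section bool_functions.
Context (R : realType).

Lemma bool_cvg_near (T : Type) (F : set_system T) {FF : Filter F}
    (s : T -> bool) (b : bool) :
  s x @[x --> F] --> b -> \forall x \near F, s x = b.
Proof. by move=> /(_ [set b]); apply; rewrite nbhs_principalE;
  exact/principal_filterP. Qed.

(* The infimum of the times at which s is true would contradict one of the
   one-sided conditions. *)
Lemma locally_constant_false (s : R -> bool) :
  s 0 = false ->
  (forall t, 0 <= t -> \forall u \near t^'+, s u = s t) ->
  (forall t, 0 < t -> \forall u \near t^'-, s u = s t) ->
  forall t, 0 <= t -> s t = false.
Proof.
move=> s0 sr sl t t0; apply/negbTE/negP => st.
pose A := [set u | 0 <= u /\ s u].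
have At : A t by [].
have lbA : lbound A 0 by move=> u [].
have infA : has_inf A by split; [exists t|exists 0].
pose c := inf A.
have c0 : 0 <= c by apply: lb_le_inf => //; exists t.
have [sc|/negbTE sc] := boolP (s c).
  have {}c0 : 0 < c.
    by rewrite lt_neqAle c0 andbT; apply/eqP => c0'; rewrite -c0' s0 in sc.
  have near_c : \forall u \near c^'-, [/\ s u = s c, 0 < u & u < c].
    by near=> u; split; near: u;
      do ?[exact: sl|exact: nbhs_left_gt|exact: nbhs_left_lt].
  have [u [su u0 uc]] := @filter_ex _ _ (at_left_proper_filter c) _ near_c.
  suff : c <= u by rewrite leNgt uc.
  by apply: (inf_lbound infA.2); split; [exact: ltW|rewrite su].
(* If [s c] is false, then [s] stays false on some [[c, c + e)], where the infimum must have
   elements of [A]. *)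
have [e /= e0 He] := (sr c c0 : nbhs c _).
have [u [u0 su] uce] := inf_adherent e0 infA.
have cu : c <= u by apply: (inf_lbound infA.2).
have {}cu : c < u.
  by rewrite lt_neqAle cu andbT; apply/eqP => cu'; rewrite -cu' sc in su.
have := He u; rewrite su sc => H.
have := H _ cu; rewrite /ball /= distrC ger0_norm ?subr_ge0 1?ltW//.
by rewrite ltrBlDl => /(_ uce).
Unshelve. all: by end_near. Qed.

End bool_functions.

(** Spins are booleans, so finitely many flips amount to adding the parity of their number. *)
Definition parity (T : choiceType) (A : set T) : bool := odd #|` fset_set A|.

Lemma parity_setU1 (T : choiceType) (A : set T) x : finite_set A -> ~ A x ->
  parity (x |` A) = ~~ parity A.
Proof.
move=> finA Ax; rewrite /parity fset_setU1// cardfsU1/=.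
rewrite in_fset_set// memNset//= add1n.
Qed.

Section loop_endpoints.

(** These are the vertices whose spins enter [energy]; they form the sets [N g] of the chains. *)
Definition endpoints (g : loop) : {fset vertex} :=
  ([fset edge_source e | e in crossed_edges g] `|`
   [fset edge_target e | e in crossed_edges g])%fset.

Lemma endpointsP (g : loop) v : reflect
  (exists2 e, e \in crossed_edges g & v = edge_source e \/ v = edge_target e)
  (v \in endpoints g).
Proof.
rewrite /endpoints in_fsetU; apply: (iffP orP).
  move=> [|] /imfsetP[e /= eg ->]; exists e => //; first by left.
  by right.
by move=> [e eg [->|->]]; [left|right]; apply/imfsetP; exists e.
Qed.

Lemma eq_flips (R : realType) (J : edge -> R) coin g k (s s' : config) :
  (forall v, v \in endpoints g -> s v = s' v) ->
  flips J coin g k s = flips J coin g k s'.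
Proof.
move=> ss'; rewrite /flips; suff -> : energy J g s = energy J g s' by [].
congr (- _); apply: eq_big_seq => e eg.
by rewrite !ss'//; apply/endpointsP; exists e => //; [right|left].
Qed.

End loop_endpoints.

Section well_definedness.
Context (R : realType) (J : edge -> R) (sigma0 : config)
  (ring : loop -> nat -> R) (coin : loop -> nat -> bool).

Let event := (loop * nat)%type.
Let time (e : event) : R := ring e.1 e.2.
Let touches (e : event) (v : vertex) : Prop := inside R e.1 v.

Definition influences (e' e : event) : Prop :=
  ring e'.1 e'.2 < ring e.1 e.2 /\
  exists2 v, v \in endpoints e.1 & inside R e'.1 v.

Hypothesis ring_gt0 : forall g k, 0 < ring g k.
Hypothesis ring_inj : forall e e' : event, ring e.1 e.2 = ring e'.1 e'.2 -> e
  = e'.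
Hypothesis locally_finite : forall v t,
  finite_set [set e : event | inside R e.1 v /\ ring e.1 e.2 <= t].
Hypothesis influences_wf : well_founded influences.

Implicit Types (fl : event -> bool).

Let upto fl v t := [set e | [/\ touches e v, time e <= t & fl e]].
Let before fl v t := [set e | [/\ touches e v, time e < t & fl e]].

(* The configuration at time t, resp. just before time t, when fl tells which
   rings flip the spins inside their loops. *)
Let state fl t : config := fun v => sigma0 v (+) parity (upto fl v t).
Let pre fl t : config := fun v => sigma0 v (+) parity (before fl v t).

Let before_finite fl v t : finite_set (before fl v t).
Proof.
apply: sub_finite_set (locally_finite v t) => e [ev et _].
by split => //; exact: ltW.
Qed.

Let right_upto fl v t : \forall u \near t^'+, upto fl v u = upto fl v t.
Proof.
(* The horizon [t + 1] is arbitrary: it leaves finitely many rings, and those after [t] keep away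
   from [t]. *)
have finX := locally_finite v (t + 1).
have : \forall u \near t^'+,
    (\bigcap_(e in [set` fset_set [set e | touches e v /\ time e <= t + 1]])
      [set u | t < time e -> u < time e]) u.
  apply: filter_bigI => e _.
  have [te|et] := ltP t (time e).
    by near=> u => _; near: u; exact: nbhs_right_lt.
  exact: nearW.
move=> H; near=> u.
have tu : t < u by near: u; exact: nbhs_right_gt.
have u1 : u < t + 1 by near: u; apply: nbhs_right_lt; rewrite ltrDl.
have Hu : forall e, touches e v -> time e <= t + 1 -> t < time e -> u < time e.
  move=> e ev et;
    have : (\bigcap_(e in [set` fset_set [set e | touches e v /\ time e <= t +
      1]])
      [set u | t < time e -> u < time e]) u by near: u.
  by apply; rewrite /= in_fset_set// inE.
apply/seteqP; split => e [ev eu fe]; split => //; last exact: le_trans (ltW tu).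
rewrite leNgt; apply/negP => te.
have := Hu e ev (le_trans eu (ltW u1)) te.
by rewrite ltNge eu.
Unshelve. all: by end_near. Qed.

Let left_upto fl v t : \forall u \near t^'-, upto fl v u = before fl v t.
Proof.
have finX := locally_finite v t.
have H : \forall u \near t^'-,
    (\bigcap_(e in [set` fset_set [set e | touches e v /\ time e <= t]])
      [set u | time e < t -> time e < u]) u.
  apply: filter_bigI => e _.
  have [et|te] := ltP (time e) t.
    by near=> u => _; near: u; exact: nbhs_left_gt.
  exact: nearW.
near=> u.
have ut : u < t by near: u; exact: nbhs_left_lt.
have Hu : forall e, touches e v -> time e < t -> time e < u.
  move=> e ev et;
    have : (\bigcap_(e in [set` fset_set [set e | touches e v /\ time e <= t]])
      [set u | time e < t -> time e < u]) u by near: u.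
  by apply => //; rewrite /= in_fset_set// inE; split => //; exact: ltW.
apply/seteqP; split => e [ev eu fe]; split => //;
  first exact: le_lt_trans eu ut.
exact/ltW/Hu.
Unshelve. all: by end_near. Qed.

Let state_ring fl e v : touches e v ->
  state fl (time e) v = pre fl (time e) v (+) fl e.
Proof.
move=> ev; rewrite /state /pre -addbA; congr (_ (+) _).
have [fe|nfe] := boolP (fl e).
  rewrite (_ : upto fl v (time e) = e |` before fl v (time e)).
    by rewrite parity_setU1// ?addbT// => -[_]; rewrite ltxx.
  apply/seteqP; split => [e' [e'v]|e' [->|[e'v lt fe']]]; last 2 first.
  - by split.
  - by split => //; exact: ltW.
  rewrite le_eqVlt => /orP[/eqP/ring_inj->|lt] fe'; first by left.
  by right; split.
rewrite addbF; congr parity; apply/seteqP; split => e' [e'v]; last first.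
  by move=> lt fe'; split => //; exact: ltW.
rewrite le_eqVlt => /orP[/eqP/ring_inj->|lt fe']; last by split.
by move=> fe; rewrite fe in nfe.
Qed.

Let state_no_ring fl v t : (forall e, touches e v -> time e <> t) ->
  state fl t v = pre fl t v.
Proof.
move=> noe; rewrite /state /pre; congr (_ (+) parity _).
apply/seteqP; split => e [ev]; last by move=> lt fe; split => //; exact: ltW.
by rewrite le_eqVlt => /orP[/eqP/noe|lt fe]; [|split].
Qed.

Let state_just_before fl t : just_before (state fl) t = pre fl t.
Proof.
apply/funext => v; apply: lim_near_cst; first exact: discrete_hausdorff.
by apply: filterS (left_upto fl v t) => u; rewrite /state /pre => ->.
Qed.

(** A trajectory is encoded by the set of rings that flip, and the dynamics becomes a fixed-point
    equation for this set. *)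
Let flip_rule fl := forall e, fl e = flips J coin e.1 e.2 (pre fl (time e)).

Let flip_rule_exists : exists fl, flip_rule fl.
Proof.
(* The recursion sees only the rings that influence [e]. The configuration so built is right at the
   endpoints of [e], which by [eq_flips] is enough. *)
pose step (e : event) (rec : forall e', influences e' e -> bool) : bool :=
  flips J coin e.1 e.2 (fun v => sigma0 v (+)
    parity [set e' | touches e' v /\ exists h : influences e' e, rec e' h]).
pose fl := Fix influences_wf (fun=> bool) step.
have flE e : fl e = step e (fun e' _ => fl e').
  apply: Fix_eq => {}e f f' ff'; congr step.
  by apply/functional_extensionality_dep => e'; apply/funext => h; exact: ff'.
exists fl => e; rewrite flE /step; apply: eq_flips => v ve.
rewrite /pre; congr (_ (+) parity _); apply/seteqP; split => e' /=.
  by move=> [e'v [[lt _] fe']]; split.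
by move=> [e'v lt fe']; split => //; unshelve eexists; first by split => //;
  exists v.
Qed.

Let flip_rule_unique fl fl' : flip_rule fl -> flip_rule fl' -> fl =1 fl'.
Proof.
move=> rfl rfl'; apply: (well_founded_ind influences_wf) => e IH.
rewrite rfl rfl'; apply: eq_flips => v ve; rewrite /pre; congr (_ (+) parity _).
have IHv e' : touches e' v -> time e' < time e -> fl e' = fl' e'.
  by move=> e'v lt; apply: IH; split => //; exists v.
apply/seteqP; split => e' [e'v lt fe']; split => //; first by rewrite -IHv.
by rewrite IHv.
Qed.

(** The flips are read off the left limits of [sigma]. The sum modulo 2 of [sigma] and [state fl] at
    a vertex is false at time 0 and, as both jump alike at rings, locally constant on both sides. *)
Let trajectory_state sigma : trajectory J sigma0 ring coin sigma ->
  exists2 fl, flip_rule fl & forall t, 0 <= t -> sigma t = state fl t.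
Proof.
move=> [s0 sr sl sring sonly].
pose fl (e : event) := flips J coin e.1 e.2 (just_before sigma (time e)).
have state0 v : state fl 0 v = sigma0 v.
  rewrite /state (_ : upto fl v 0 = set0) /parity ?fset_set0 ?addbF//.
  by rewrite -subset0 => -[g k] [_]; rewrite leNgt ring_gt0.
have left_sigma v t : 0 < t -> \forall u \near t^'-, sigma u v = just_before
  sigma t v.
  by move=> t0; apply: bool_cvg_near; exact: sl.
have stateE t v : 0 <= t -> sigma t v = state fl t v.
  move=> t0; apply/eqP; rewrite -negb_add; apply/negPf.
  apply: (@locally_constant_false _ (fun t => sigma t v (+) state fl t v)) t0.
  - by rewrite s0 state0 addbb.
  - move=> {}t t0; near=> u; congr (_ (+) _).
      by near: u; apply: bool_cvg_near; exact: sr.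
    by rewrite /state; congr (_ (+) parity _); near: u; exact: right_upto.
  - move=> {}t t0; near=> u.
    have -> : sigma u v = just_before sigma t v by near: u; exact: left_sigma.
    have -> : state fl u v = pre fl t v.
      by rewrite /state /pre; congr (_ (+) parity _); near: u; exact: left_upto.
    have [[e [ev et]]|noe] := pselect (exists e, touches e v /\ time e = t).
      rewrite -et state_ring// -[in RHS]/(ring e.1 e.2) sring//.
      by rewrite [RHS]addbACA addbb addbF.
    rewrite state_no_ring; last by move=> e ev et; apply: noe; exists e.
    congr (_ (+) _); apply: contrapT => /nesym neq.
    have [g [k [gt gv]]] := sonly v t t0 neq.
    by apply: noe; exists (g, k).
exists fl; last by move=> t t0; apply/funext => v; exact: stateE.
move=> e; rewrite {1}/fl; congr flips; rewrite -state_just_before.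
have e0 : 0 < time e by exact: ring_gt0.
apply/funext => v; rewrite state_just_before.
apply: lim_near_cst; first exact: discrete_hausdorff.
near=> u; rewrite stateE; last by near: u; exact: nbhs_left_ge.
by rewrite /state /pre; congr (_ (+) parity _); near: u; exact: left_upto.
Unshelve. all: by end_near. Qed.

Lemma well_defined_of_wf : well_defined J sigma0 ring coin.
Proof.
have [fl rfl] := flip_rule_exists.
exists (state fl); last first.
  move=> sigma' /trajectory_state[fl' rfl' E] t t0.
  by rewrite E//; congr state; apply/funext; exact: flip_rule_unique.
split.
- apply/funext => v; rewrite /state (_ : upto fl v 0 = set0) /parity.
    by rewrite fset_set0 addbF.
  by rewrite -subset0 => -[g k] [_]; rewrite leNgt ring_gt0.
- move=> v t t0; apply: cvg_near_cst.
  by apply: filterS (right_upto fl v t) => u; rewrite /state => ->.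
- move=> v t t0; apply: (@is_cvg_near_cst _ _ (pre fl t v)).
  by apply: filterS (left_upto fl v t) => u; rewrite /state /pre => ->.
- move=> g k v gk gv; rewrite state_just_before.
  by rewrite -(rfl (g, k)) -(state_ring fl (e := (g, k))).
- move=> v t t0; rewrite state_just_before => neq.
  have [[[g k] [ev et]]|noe] := pselect (exists e, touches e v /\ time e = t).
    by exists g, k.
  exfalso; apply: neq; apply: state_no_ring => e ev et; apply: noe.
  by exists e.
Qed.

End well_definedness.

(** * Endpoints and translations of loops *)

Section symmetric_endpoints.

(* A dual edge and the primal edge that it crosses have the same midpoint, so
   the endpoints of the latter are the vertices at l^1-distance 1/2 from the
   midpoint of the dual points x and y. *)
Definition faces (x y v : vertex) : bool :=
  `|2 * v.1 - (x.1 + y.1) - 1| + `|2 * v.2 - (x.2 + y.2) - 1| == 1.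

Lemma vertex_eq (u v : vertex) : u.1 = v.1 -> u.2 = v.2 -> u = v.
Proof. by case: u v => [? ?] [? ?] /= -> ->. Qed.

Lemma edge_betweenE (e : edge) :
  Defs.adjacent (edge_source e) (edge_target e) /\
  edge_between (edge_source e) (edge_target e) = e.
Proof.
case: e => [[a b] []];
  rewrite /edge_source /edge_target /edge_between /Defs.adjacent /=;
  split; do ?[congr ((_, _), _)]; lia.
Qed.

Lemma faces_crossed (x y v : vertex) : Defs.adjacent x y ->
  faces x y v <-> v = edge_source (crossed_edge (edge_between x y)) \/
                  v = edge_target (crossed_edge (edge_between x y)).
Proof.
case: x y v => [x1 x2] [y1 y2] [v1 v2];
  rewrite /Defs.adjacent /faces /edge_source
  /edge_target /crossed_edge /edge_between /= => xy.
have [xy1|xy1] := eqVneq x1 y1; rewrite /=; split.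
- by move=> H; have [e|e] : v1 = x1 \/ v1 = x1 + 1; [lia|left|right];
  apply: vertex_eq => /=; lia.
- by move=> [] [-> ->]; lia.
- by move=> H; have [e|e] : v2 = x2 \/ v2 = x2 + 1; [lia|left|right];
  apply: vertex_eq => /=; lia.
- by move=> [] [-> ->]; lia.
Qed.

Lemma endpoints_faces (g : loop) v : v \in endpoints g <->
  exists x y, [/\ Defs.adjacent x y, edge_between x y \in loop_edges g & faces
    x y v].
Proof.
split.
  move=> /endpointsP[_ /imfsetP[e /= eg ->] ve].
  have [adj eE] := edge_betweenE e.
  by exists (edge_source e), (edge_target e); rewrite eE; split => //;
    apply/faces_crossed; rewrite ?eE.
move=> [x [y [adj xyg /faces_crossed vxy]]]; apply/endpointsP.
exists (crossed_edge (edge_between x y)); last exact: vxy.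
by apply/imfsetP; exists (edge_between x y).
Qed.

(** [psi] is the same plane symmetry acting on primal vertices. The rotation and the reflection fix
    the point (1/2, 1/2), whence the terms [1 - v.2] and [1 - v.1]. *)
Lemma lattice_symmetry_faces phi : lattice_symmetry phi ->
  exists2 psi : vertex -> vertex, injective psi &
    forall x y v, faces x y v -> faces (phi x) (phi y) (psi v).
Proof.
elim=> [[a b]|||phi1 phi2 _ [psi1 i1 f1] _ [psi2 i2 f2]].
- exists (fun v => v + (a, b)); first exact: addIr.
  by move=> [x1 x2] [y1 y2] [v1 v2]; rewrite /faces /=; lia.
- exists (fun v => (1 - v.2, v.1)); first by move=> [? ?] [? ?] [? ->];
  congr pair; lia.
  by move=> [x1 x2] [y1 y2] [v1 v2]; rewrite /faces /=; lia.
- exists (fun v => (1 - v.1, v.2)); first by move=> [? ?] [? ?] [? ->];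
  congr pair; lia.
  by move=> [x1 x2] [y1 y2] [v1 v2]; rewrite /faces /=; lia.
- exists (psi1 \o psi2); first exact: inj_comp.
  by move=> x y v /f2/f1.
Qed.

Lemma congruent_endpoints g h : congruent g h ->
  (#|` endpoints g| <= #|` endpoints h|)%N.
Proof.
move=> /asboolP[phi sphi gh].
have [psi psi_inj f] := lattice_symmetry_faces sphi.
have <- : #|` [fset psi v | v in endpoints g]%fset| = #|` endpoints g|.
  by rewrite card_imfset.
rewrite fsubset_leq_card//.
apply/fsubsetP => _ /imfsetP[v /= /endpoints_faces[x [y [adj xyg fxyv]]] ->].
apply/endpoints_faces; exists (phi x), (phi y); split; last exact: f.
- by rewrite lattice_symmetry_adjacent.
- by rewrite gh.
Qed.

Lemma endpoints_loop_size (R : realType) (g : loop) :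
  ((#|` endpoints g|%:R)%:E <= loop_size R g)%E.
Proof.
rewrite /loop_size /counting; case: asboolP => [fin|_]; last by rewrite leey.
rewrite lee_fin ler_nat fsubset_leq_card//.
apply/fsubsetP => v /endpointsP vg; rewrite in_fset_set// inE; right.
exact: vg.
Qed.

Lemma loop_edges_neq0 (g : loop) : loop_edges g != fset0.
Proof.
case: g => g /[dup] /asboolP[[//|x c] _ ->] lg.
by apply/fset0Pn; exists (edge_between x (next (x :: c) x)); apply/imfsetP;
  exists x => //=; rewrite inE eqxx.
Qed.

Lemma endpoints_neq0 (g : loop) : exists v, v \in endpoints g.
Proof.
have /fset0Pn[e eg] := loop_edges_neq0 g.
exists (edge_source (crossed_edge e)); apply/endpointsP.
by exists (crossed_edge e); [apply/imfsetP; exists e|left].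
Qed.

End symmetric_endpoints.

Section translations.

Definition translate_edge (a : vertex) (e : edge) : edge := (e.1 + a, e.2).

Definition translate_edges (a : vertex) (g : {fset edge}) : {fset edge} :=
  [fset translate_edge a e | e in g]%fset.

Lemma edge_between_translate a x y :
  edge_between (x + a) (y + a) = translate_edge a (edge_between x y).
Proof.
case: a x y => [a1 a2] [x1 x2] [y1 y2];
  rewrite /edge_between /translate_edge /=.
congr pair; first by apply: vertex_eq => /=; lia.
by rewrite /= (inj_eq (addIr _)).
Qed.

Lemma translate_is_loop a g : is_loop g -> is_loop (translate_edges a g).
Proof.
move=> /asboolP[c /and3P[c2 uc cc] ->]; apply/asboolP.
pose h (x : vertex) := x + a.
have h_inj : injective h by exact: addIr.
exists (map h c).
  rewrite /simple_cycle size_map map_inj_uniq// c2 uc/=.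
  rewrite cycle_map; apply: sub_cycle cc => x y /=.
  by rewrite -(lattice_symmetry_adjacent _ _ (symmetry_translation a)).
apply/fsetP => e; apply/imfsetP/imfsetP => /= [[_ /imfsetP[x /= xc ->] ->]|].
  exists (h x); first exact: map_f.
  by rewrite next_map// edge_between_translate.
move=> [_ /mapP[x xc ->] ->]; exists (edge_between x (next c x)).
  by apply/imfsetP; exists x.
by rewrite next_map// edge_between_translate.
Qed.

Definition translate (a : vertex) (g : loop) : loop :=
  exist _ (translate_edges a (val g)) (translate_is_loop a (valP g)).

Lemma translate_edge_inj a : injective (translate_edge a).
Proof.
move=> [x b] [y c] xy; have /= -> := congr1 snd xy.
by have /addIr/= -> := congr1 fst xy.
Qed.

Lemma mem_translate a g e :
  (translate_edge a e \in loop_edges (translate a g)) = (e \in loop_edges g).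
Proof. by rewrite mem_imfset//; exact: translate_edge_inj. Qed.

Lemma translate_inj a : injective (translate a).
Proof.
move=> g h gh; apply/val_inj/fsetP => e.
by have := mem_translate a g e; rewrite gh mem_translate => <-.
Qed.

Lemma congruent_translate a g : congruent g (translate a g).
Proof.
apply/asboolP; exists (fun x => x + a); first exact: symmetry_translation.
by move=> x y _; rewrite edge_between_translate mem_translate.
Qed.

Context (R : realType).

Let shift (a : vertex) : R * R := (a.1%:~R, a.2%:~R).

Lemma dual_segment_translate a e (p : R * R) :
  dual_segment (translate_edge a e) (p + shift a) <-> dual_segment e p.
Proof.
have src : @dual_point R (edge_source (translate_edge a e)) =
    @dual_point R (edge_source e) + shift a.
  by rewrite /dual_point /edge_source /shift /=; congr pair; rewrite /= intrD;
    ring.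
have tgt : @dual_point R (edge_target (translate_edge a e)) =
    @dual_point R (edge_target e) + shift a.
  by rewrite /dual_point /edge_target /shift /=; congr pair; rewrite /= !intrD;
    ring.
have segE t : (1 - t) *: @dual_point R (edge_source (translate_edge a e)) +
    t *: @dual_point R (edge_target (translate_edge a e)) =
    (1 - t) *: @dual_point R (edge_source e) + t *: @dual_point R (edge_target
      e) +
    shift a.
  by rewrite src tgt !scalerDr addrACA -scalerDl subrK scale1r.
split=> [[t t01]|[t t01 <-]]; last by exists t; rewrite ?segE.
by rewrite segE => /addIr <-; exists t.
Qed.

Lemma loop_trace_translate a g (p : R * R) :
  loop_trace (translate a g) (p + shift a) <-> loop_trace g p.
Proof.
split => [[_ /= /imfsetP[e /= eg ->] /dual_segment_translate ep]|[e eg ep]].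
  by exists e.
exists (translate_edge a e); last exact/dual_segment_translate.
by rewrite /= mem_translate.
Qed.

(** The component of the translated point, shifted back, is connected, avoids the trace of [g] and
    contains the original point, so it lies in a bounded component. *)
Lemma inside_translate a g v : inside R g v -> inside R (translate a g) (v + a).
Proof.
have pp : @primal_point R (v + a) = @primal_point R v + shift a.
  by rewrite /primal_point /shift /=; congr pair; rewrite /= intrD.
move=> [vg bdd]; split; rewrite pp; first by move=> /loop_trace_translate.
set K := connected_component _ _ in bdd.
set K' := connected_component _ _.
have K'K q : K' q -> K (q - shift a).
  move=> K'q.
  suff : (fun q => q - shift a) @` K' `<=` K by apply; exists q.
  apply: connected_component_max.
  - exists (@primal_point R v + shift a); last by rewrite addrK.
    apply: connected_component_refl => /loop_trace_translate; exact: vg.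
  - move=> _ [z K'z <-] /(loop_trace_translate a); rewrite subrK.
    exact: connected_component_sub K'z.
  - apply: connected_continuous_connected; first exact: component_connected.
    apply: continuous_subspaceT => z.
    by apply: cvgB; [exact: cvg_id|exact: cvg_cst].
have [M [_ /(_ (M + 1)) KM]] := bdd.
exists (M + 1 + `|shift a|); split; first exact: num_real.
move=> r Mr q /K'K/KM qM; apply: le_trans (ltW Mr).
rewrite -(subrK (shift a) q); apply: le_trans (ler_normD _ _) _.
by rewrite lerD2r qM// ltrDl.
Qed.

End translations.

(** * Finiteness of the backward chains *)

(** A non-accessible element has a non-accessible predecessor; repeated choice of one gives a
    descending sequence. *)
Lemma well_founded_no_descent (T : Type) (r : T -> T -> Prop) :
  (forall s : nat -> T, ~ (forall n, r (s n.+1) (s n))) -> well_founded r.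
Proof.
move=> nodesc x; apply: contrapT => nx.
have next (y : {y | ~ Acc r y}) : exists z : {z | ~ Acc r z}, r (sval z) (sval
  y).
  case: y => y ny /=; apply: contrapT => nz; apply: ny; constructor => z zy.
  by apply: contrapT => az; apply: nz; exists (exist _ z az).
have [h hP] := choice next.
apply: (nodesc (fun n => sval (iter n h (exist _ x nx)))) => n.
exact: hP.
Qed.

Section infinite_chains.
Context (R : realType) (L : countType) (V : choiceType).
Variables (ins : L -> set V) (N : L -> {fset V}) (lam : R) (wt : L -> nat -> R).
Hypothesis wt_gt0 : forall g k, 0 < wt g k.
Hypothesis chains_lty : forall v,
  (\esum_(es in [set es | reaches ins N v es]) (weight lam wt es)%:E < +oo)%E.

Lemma clock_lt g k l : (k < l)%N -> clock wt g k < clock wt g l.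
Proof.
elim: l => // l IH; rewrite ltnS /clock big_ord_recr/= => kl.
have [->|kl'] := eqVneq k l; first by rewrite ltrDl.
by apply: lt_trans (IH _) _; [rewrite ltn_neqAle kl' kl|rewrite ltrDl].
Qed.

Lemma event_time_gt0 e : 0 < event_time wt e.
Proof.
have := @clock_lt e.1 0 e.2.+1 isT.
by rewrite /clock big_ord0.
Qed.

Lemma finite_heavy_chains v t : finite_set
  [set es | reaches ins N v es /\ expR (- lam * t) <= weight lam wt es].
Proof.
have heavy := esum_lty_finite (expR_gt0 (- lam * t)) _ (chains_lty v).
apply: sub_finite_set (heavy _) => [es [ves] //|].
by move=> es; rewrite lee_fin weight_ge0.
Qed.

(** Each such event is by itself a chain from [v] of weight at least e^(-lam t), so local finiteness
    is the case of chains of length 1. *)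
Lemma finite_events v t : 0 < lam -> (forall g, exists u, u \in N g) ->
  finite_set [set e : L * nat | ins e.1 v /\ event_time wt e <= t].
Proof.
move=> lam0 N0.
have fin := finite_heavy_chains v t.
pose hd (es : seq (L * nat)) := if es is e :: _ then [set e] else set0.
apply: sub_finite_set (bigcup_finite fin (F := hd) _); last first.
  by move=> [|e es] _; [exact: finite_set0|exact: finite_set1].
move=> e [ev et]; exists [:: e] => //; split => /=.
  by split => //; have [u uN] := N0 e.1; exists u.
rewrite /weight /= /next_index big_nil /= event_time_gt0/=.
by rewrite ler_expR !mulNr lerN2 ler_wpM2l// ltW.
Qed.

Section runs.
Variable s : nat -> L * nat.
Hypothesis s_lt : forall n, event_time wt (s n.+1) < event_time wt (s n).
Hypothesis s_ins : forall n, exists2 v, v \in N (s n).1 & ins (s n.+1).1 v.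

Fixpoint run (n i : nat) : seq (L * nat) :=
  if n is n'.+1 then s i :: run n' i.+1 else [::].

Lemma size_run n i : size (run n i) = n.
Proof. by elim: n i => //= n IH i; rewrite IH. Qed.

Lemma run_reaches n i v : ins (s i).1 v -> reaches ins N v (run n i).
Proof.
elim: n i v => //= n IH i v iv; split => //.
by have [u uN uS] := s_ins i; exists u => //; exact: IH.
Qed.

Lemma event_time_run n i e : e \in run n i.+1 -> event_time wt e < event_time
  wt (s i).
Proof.
elim: n i => //= n IH i; rewrite inE => /orP[/eqP->//|/IH lt].
exact: lt_trans lt (s_lt i).
Qed.

Lemma run_descending n i : descending wt (run n i).
Proof.
elim: n i => //= n IH i; rewrite IH andbT; apply/andP; split.
  (* On a single clock, an earlier ring has a smaller index because waiting times are positive. *)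
  apply/bigmax_leqP_seq => e /event_time_run lt /eqP eg.
  rewrite ltnNge; apply/negP => le; move: lt; rewrite ltNge => /negP; apply.
  rewrite /event_time eg.
  have [->//|ne] := eqVneq (s i).2 e.2.
  by apply/ltW/clock_lt; rewrite ltnS ltn_neqAle ne.
by case: n {IH} => [|n] /=; [exact: event_time_gt0|exact: s_lt].
Qed.

(** The weight of a chain depends only on its latest time, so all nonempty runs from [s 1] have the
    same positive weight; there are infinitely many, told apart by their sizes. *)
Lemma no_infinite_run : False.
Proof.
(* Runs start at [s 1] because [s_ins] provides a vertex inside the loop of [s n.+1], not of
   [s 0]. *)
have [v _ v1] := s_ins 0.
have fin := finite_heavy_chains v (event_time wt (s 1)).
apply: infinite_nat.
apply: sub_finite_set (finite_image (fun es => (size es).-1) fin) => n _.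
exists (run n.+1 1); last by rewrite size_run.
by split; [exact: run_reaches|rewrite /weight run_descending].
Qed.

End runs.
End infinite_chains.

(** * The total rate of the loops around a vertex *)

Section total_rate.
Context (R : realType) (f : loop -> R).
Hypothesis f_gt0 : forall g, 0 < f g.
Hypothesis f_proper : proper_frequencies f.

Lemma type_of_congruent g h : congruent g h -> type_of g = type_of h.
Proof. by move=> gh; apply/eqmodP. Qed.

Lemma congruent_repr g : congruent g (repr (type_of g)).
Proof. by apply/eqmodP; rewrite -[LHS]reprK. Qed.

(** Translation by [- v] is injective, preserves types and sends loops around [v] to loops around
    the origin, which are then grouped by type. Congruence is used on [endpoints] only; interiors
    are merely translated. *)
Lemma total_rate_le v :
  (\esum_(g in [set g | inside R g v]) (f g * #|` endpoints g|%:R)%:E <=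
   \esum_(t in [set: loop_type])
     (type_number R t * (type_frequency f t)%:E * type_size R t))%E.
Proof.
pose b t := ((type_frequency f t)%:E * type_size R t)%E.
have size0 t : (0 <= type_size R t)%E.
  by rewrite /type_size (le_trans _ (endpoints_loop_size _ _)) ?lee_fin.
have b0 t : (0 <= b t)%E by rewrite mule_ge0// lee_fin ltW// f_gt0.
apply: (@le_trans _ _ (\esum_(g in [set g | inside R g v])
    b (type_of (translate (- v)%R g)))%E).
  apply: le_esum => g gv.
  rewrite -(type_of_congruent (congruent_translate (- v) g)) /b EFinM.
  have gr := congruent_repr g.
  rewrite /type_frequency (f_proper gr); apply: lee_wpmul2l.
    by rewrite lee_fin ltW.
  rewrite /type_size; apply: le_trans (endpoints_loop_size _ _).
  by rewrite lee_fin ler_nat congruent_endpoints.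
rewrite -(esum_image _ (translate (- v)) (fun g => b (type_of g))); last first.
  by move=> g h _ _; exact: translate_inj.
apply: (@le_trans _ _ (\esum_(g in [set g | inside R g (0, 0)%R]) b (type_of
  g))%E).
  apply: esum_subset => // _ [g gv <-] /=.
  by have := inside_translate (- v) gv; rewrite subrr.
pose J t := [set g | type_of g = t /\ inside R g (0, 0)].
rewrite (reindex_esum ([set: loop_type] `*`` J) _ snd); last first.
  split.
  - by move=> [t g] [_ [_ /= g0]].
  - by move=> [t g] [u h] /[!inE] -[_ [/= <- _]] [_ [/= <- _]] /= ->.
  - by move=> g g0; exists (type_of g, g).
rewrite -(@esum_esum _ _ _ _ J (fun _ g => b (type_of g)))//.
apply: le_esum => t _; rewrite -muleA.
rewrite (eq_esum (b := fun=> b t)); last by move=> g [->].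
exact: esum_cst_counting.
Qed.

End total_rate.

(** * Almost sure well-definedness *)

Lemma preimage_event_measurable d d' (T : measurableType d)
    (T' : measurableType d') (X : {mfun T >-> T'}) A :
  g_sigma_algebra_preimage X A -> measurable A.
Proof. by move=> [B mB <-]; exact: measurable_funP. Qed.

Lemma preimage_event_setT d d' (T : measurableType d) (T' : measurableType d')
    (X : T -> T') : g_sigma_algebra_preimage X setT.
Proof. by exists setT => //; rewrite preimage_setT setTI. Qed.

Lemma preimage_event_setI d d' (T : measurableType d) (T' : measurableType d')
    (X : T -> T') : setI_closed (g_sigma_algebra_preimage X).
Proof.
move=> _ _ [B mB <-] [C mC <-]; exists (B `&` C); first exact: measurableI.
by rewrite !setTI preimage_setI.
Qed.

Unset Implicit Arguments.

Theorem theorem49 (R : realType) (d : measure_display)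
  (Omega : measurableType d) (P : probability Omega R)
  (f : loop -> R)
  (J : edge -> {RV P >-> R}) (sigma0 : vertex -> {RV P >-> bool})
  (wait : loop -> nat -> {RV P >-> R}) (coin : loop -> nat -> {RV P >-> bool})
  (f_gt0 : forall g, 0 < f g)
  (f_proper : proper_frequencies f)
  (J_law : forall e e', has_law (J e) (distribution P (J e')))
  (J_integrable : forall e, P.-integrable setT (EFin \o J e))
  (sigma0_law : forall v, has_law (sigma0 v) (bernoulli_prob 2^-1))
  (wait_law : forall g k, has_law (wait g k) (exponential_prob (f g)))
  (coin_law : forall g k, has_law (coin g k) (bernoulli_prob 2^-1))
  (independence :
    mutually_independent P (source_events J sigma0 wait coin))
  (summable :
    (\esum_(t in [set: loop_type])
       (type_number R t * (type_frequency f t)%:E * type_size R t) < +oo)%E) :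
  {ae P, forall w,
    well_defined (fun e => J e w) (fun v => sigma0 v w)
      (ring_time (fun g k => wait g k w)) (fun g k => coin g k w)}.
Proof.
pose F := source_events J sigma0 wait coin.
have F_measurable i A : F i A -> measurable A.
  by case: i => [[[e|v]|[g k]]|[g k]]; exact: preimage_event_measurable.
have F_setT i : F i setT.
  by case: i => [[[e|v]|[g k]]|[g k]]; exact: preimage_event_setT.
have F_setI i : setI_closed (F i).
  by case: i => [[[e|v]|[g k]]|[g k]]; exact: preimage_event_setI.
pose src g k : source := inl (inr (g, k)).
have src_inj g h k l : src g k = src h l -> (g, k) = (h, l) by case=> -> ->.
have wait_src g k B : measurable B -> F (src g k) (wait g k @^-1` B).
  by move=> mB; exists B => //; rewrite setTI.
set C := (\esum_(t in _) _)%E in summable.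
have C0 : (0 <= C)%E.
  apply: le_trans (total_rate_le f_gt0 f_proper (0, 0)).
  by apply: esum_ge0 => g _; rewrite lee_fin mulr_ge0// ltW.
have C_fin : C = (fine C)%:E by rewrite fineK// ge0_fin_numE.
have c0 : 0 <= fine C by rewrite fine_ge0.
(* Twice the total rate makes each step of a chain cost a factor at most 1/2; adding 1 keeps [lam]
   positive. *)
pose lam : R := 2 * fine C + 1.
have lam0 : 0 < lam by rewrite ltr_wpDl// mulr_ge0.
have rate_le v : (\esum_(g in [set g | inside R g v])
    (f g / lam * #|` endpoints g|%:R)%:E <= (2^-1)%:E)%E.
  apply: (@le_trans _ _ (lam^-1%:E * \esum_(g in [set g | inside R g v])
      (f g * #|` endpoints g|%:R)%:E)%E).
    apply: le_esum_scale => [||g _]; first by rewrite invr_ge0 ltW.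
      by move=> g _; rewrite lee_fin mulr_ge0// ltW.
    by rewrite -EFinM lee_fin mulrAC mulrC mulrA.
  apply: (@le_trans _ _ (lam^-1%:E * C)%E).
    apply: lee_wpmul2l; first by rewrite lee_fin invr_ge0 ltW.
    exact: total_rate_le.
  rewrite C_fin -EFinM lee_fin mulrC ler_pdivrMr// /lam.
  by rewrite mulrDr mulKf// lerDl mulr1 invr_ge0.
have chains := ae_chains_lty F_measurable F_setT F_setI independence f_gt0
  wait_law src_inj wait_src lam0 rate_le.
have pos := ae_wait_gt0 f_gt0 wait_law.
have neq := ae_event_time_neq F_measurable F_setT F_setI independence f_gt0
  wait_law src_inj wait_src.
move: chains pos neq; apply: filterS3 => w chains_lty wt_gt0 time_neq.
apply: well_defined_of_wf.
(* [ring_time] and [event_time] are the same partial sums up to unfolding. *)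
- by move=> g k; exact: (event_time_gt0 wt_gt0 (g, k)).
- move=> [g k] [h l] E; have [gh|gh] := eqVneq g h; last first.
    by have := time_neq (g, k) (h, l) gh; rewrite /event_time /= => /eqP.
  rewrite -gh in E *; congr pair; case: (ltngtP k l) => //; rewrite -ltnS.
  + by move=> /(clock_lt wt_gt0 g); rewrite lt_neqAle [X in ~~ X](introT eqP E).
  + move=> /(clock_lt wt_gt0 g); rewrite lt_neqAle eq_sym.
    by rewrite [X in ~~ X](introT eqP E).
- move=> v t; exact: (finite_events wt_gt0 chains_lty v t lam0 endpoints_neq0).
- apply: well_founded_no_descent => s descent.
  apply: (@no_infinite_run _ _ _ _ _ _ _ wt_gt0 chains_lty s) => n.
  + by have [] := descent n.
  + by have [_ [v vN vs]] := descent n; exists v.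
Qed.
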